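(* Let $\beta>0$ and suppose $f\in S_{\beta}$, with representing measure $\mu_{\beta}\in\mathcal{M}_{\beta}$. Then $\beta>\alpha^*[f]$ if and only if there exists $\varepsilon\in(0,\min\{\beta,1\})$ such that the function $$\Phi(y)=\int_{[0,y)}\frac{\mu_{\beta}(du)}{(y-u)^{\varepsilon}}$$ is non-decreasing on $(0,\infty)$.
   Context: For $\alpha>0$, $\mathcal{M}_{\alpha}$ denotes the set of non-negative Borel measures $\mu$ on $[0,\infty]$ (the one-point compactification of $[0,\infty)$) with $\int_{[0,\infty)}(1+t)^{-\alpha}\mu(dt)<\infty$ and $\mu(\{\infty\})<\infty$; write $\mu_0=\mu(\{0\})$, $\mu_\infty=\mu(\{\infty\})$. For $\alpha>0$, $S_{\alpha}$ is the class of functions on $\mathbb{C}\setminus(-\infty,0]$ of the form $$f(z)=\int_{(0,\infty)}\frac{\mu_{\alpha}(du)}{(u+z)^{\alpha}}+\mu_{\infty}+\frac{\mu_0}{z^{\alpha}},\qquad \mu_\alpha\in\mathcal{M}_\alpha,$$ where the branch of the power is the one positive on the positive half-axis; $\mu_\alpha$ is called the measure representing $f$ in $S_\alpha$ (it is unique). $S_\infty=\bigcup_{\alpha>0}S_\alpha$ (note $S_\alpha\subset S_\beta$ for $\alpha<\beta$), and $S_0$ is the set of non-negative constants. For $f\in S_\infty$ the exact Stieltjes order is $\alpha^*[f]=\inf\{\alpha:\ f\in S_{\alpha}\}$. *)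

(* Defs.v *)
(* MathComp-Analysis, with the complex numbers R[i] of mathcomp-real-closed. *)
From mathcomp Require Import all_boot all_order all_algebra.
From mathcomp Require Import complex.
From mathcomp Require Import all_classical all_reals all_analysis.
From mathcomp Require Import measurable_realfun.
From mathcomp Require Import ring lra.

Set Implicit Arguments.
Unset Strict Implicit.
Unset Printing Implicit Defensive.

Import Order.TTheory GRing.Theory Num.Theory.
Import numFieldNormedType.Exports.
Local Open Scope classical_set_scope.
Local Open Scope ring_scope.

Definition slit_plane (R : realType) : set R[i] :=
  [set z | ~ (complex.Im z = 0 /\ complex.Re z <= 0)].

Definition cmodulus (R : realType) (w : R[i]) : R :=
  Num.sqrt (complex.Re w ^+ 2 + complex.Im w ^+ 2).

(* The argument in ]-pi, pi[ of w in the slit plane, by the half-angle formula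
   tan (theta / 2) = Im w / (|w| + Re w); the denominator is then nonzero. *)
Definition carg (R : realType) (w : R[i]) : R :=
  2 * atan (complex.Im w / (cmodulus w + complex.Re w)).

(* Principal branch of w ^ a for real a, meaningful on the slit plane. *)
Definition cpow (R : realType) (w : R[i]) (a : R) : R[i] :=
  ((cmodulus w `^ a)%:C * (cos (a * carg w) +i* sin (a * carg w)))%C.

Lemma carg_bound (R : realType) (w : R[i]) : - pi < carg w < pi.
Proof.
rewrite /carg; set x := _ / _.
have := atan_gtNpi2 x; have := atan_ltpi2 x; lra.
Qed.

Lemma carg_polar (R : realType) (w : R[i]) : slit_plane w ->
  w = ((cmodulus w)%:C * (cos (carg w) +i* sin (carg w)))%C.
Proof.
case: w => a b; rewrite /slit_plane /= => nab.
set r := cmodulus (a +i* b)%C; set d := r + a.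
have r0 : 0 <= r by exact: sqrtr_ge0.
have r2 : r ^+ 2 = a ^+ 2 + b ^+ 2.
  by rewrite /r /cmodulus /= sqr_sqrtr// addr_ge0// sqr_ge0.
have d0 : 0 < d.
  rewrite ltNge; apply/negP => dle0; apply: nab.
  rewrite /d in dle0.
  have b0 : b ^+ 2 = 0 by have := sqr_ge0 b; nra.
  by split; [apply/eqP; rewrite -sqrf_eq0 b0|lra].
have dn0 : d != 0 by rewrite gt_eqF.
have td : d ^+ 2 + b ^+ 2 = 2 * r * d by rewrite /d; nra.
have rn0 : r != 0 by apply/eqP => re; move: d0 r2; rewrite /d re; nra.
pose t := b / d; pose c := cos (atan t).
have c0 : c != 0 by rewrite gt_eqF// cos_gt0_pihalf// atan_gtNpi2 atan_ltpi2.
have sc : sin (atan t) = t * c.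
  by rewrite -[X in X * c](atanK t) /tan -mulrA mulVf ?mulr1.
have c2 : c ^+ 2 * (2 * r) = d.
  have : c ^+ 2 * (1 + t ^+ 2) = 1.
    by rewrite -[RHS](cos2Dsin2 (atan t)) sc -/c; ring.
  rewrite (_ : 1 + t ^+ 2 = 2 * r / d); last first.
    have -> : 1 + t ^+ 2 = (d ^+ 2 + b ^+ 2) / d ^+ 2 by rewrite /t; field.
    by rewrite td; field.
  move=> h; have -> : c ^+ 2 * (2 * r) = d * (c ^+ 2 * (2 * r / d)) by field.
  by rewrite h mulr1.
have -> : cos (carg (a +i* b)%C) = 2 * c ^+ 2 - 1.
  by rewrite /carg /= -/r -/d -/t mulr_natl cos_mulr2n -/c mulr_natl.
have -> : sin (carg (a +i* b)%C) = 2 * (t * c * c).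
  by rewrite /carg /= -/r -/d -/t mulr_natl sin_mulr2n sc -/c -mulr_natl [c * _]mulrC.
apply/eqP; rewrite eq_complex /= !mul0r subr0 addr0.
have -> : r * (2 * c ^+ 2 - 1) = c ^+ 2 * (2 * r) - r by ring.
have -> : r * (2 * (t * c * c)) = t * (c ^+ 2 * (2 * r)) by ring.
by rewrite c2 /t /d (addrC r) addrK addrC divfK ?eqxx.
Qed.

(* A measure on [0, +oo] is encoded as a Borel measure on \bar R that does not
   charge [-oo, 0[. *)
Definition stieltjes_measure (R : realType) (alpha : R) :
    set {measure set (\bar R) -> \bar R} :=
  [set mu | [/\ mu [set t | (t < 0)%E] = 0%E,
    (\int[mu]_(t in [set t | (0 <= t < +oo)%E])
       ((1 + fine t) `^ (- alpha))%:E < +oo)%E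
    & (mu [set +oo%E] < +oo)%E]].

Definition cRintegral (R : realType) (mu : {measure set (\bar R) -> \bar R})
    (D : set (\bar R)) (g : \bar R -> R[i]) : R[i] :=
  (Rintegral mu D (fun u => complex.Re (g u)) +i*
   Rintegral mu D (fun u => complex.Im (g u)))%C.

(* For mu in stieltjes_measure alpha and z in the slit plane, the integrand is
   integrable because |u + z| >= c_z * (1 + u), and the masses at 0 and +oo are
   finite, so no default value of [Rintegral] or [fine] is ever used. *)
Definition stieltjes_transform (R : realType) (alpha : R)
    (mu : {measure set (\bar R) -> \bar R}) (z : R[i]) : R[i] :=
  cRintegral mu [set u | (0 < u < +oo)%E]
    (fun u => cpow ((fine u)%:C%C + z) (- alpha))
  + (fine (mu [set +oo%E]))%:C%C
  + (fine (mu [set 0%E]))%:C%C * cpow z (- alpha).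

(* Only the values of f on the slit plane matter. *)
Definition represents (R : realType) (alpha : R)
    (mu : {measure set (\bar R) -> \bar R}) (f : R[i] -> R[i]) : Prop :=
  stieltjes_measure alpha mu /\
  forall z, slit_plane z -> f z = stieltjes_transform alpha mu z.

(* Empty for alpha < 0. *)
Definition stieltjes_class (R : realType) (alpha : R) : set (R[i] -> R[i]) :=
  [set f | (alpha = 0 /\ exists2 c : R, 0 <= c &
             forall z, slit_plane z -> f z = c%:C%C)
        \/ (0 < alpha /\ exists mu, represents alpha mu f)].

Definition stieltjes_order (R : realType) (f : R[i] -> R[i]) : R :=
  inf [set alpha : R | stieltjes_class alpha f].

(* Valued in the extended reals: the integral may a priori be infinite. *)
Definition fractional_potential (R : realType)
    (mu : {measure set (\bar R) -> \bar R}) (eps y : R) : \bar R :=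
  (\int[mu]_(u in [set u | 0 <= u < y%:E]) ((y - fine u) `^ (- eps))%:E)%E.

(* Main.v *)
From HB Require Import structures.
Require Import Defs.
From mathcomp Require Import all_boot all_order all_algebra.
From mathcomp Require Import complex.
From mathcomp Require Import all_classical all_reals all_analysis.
From mathcomp Require Import measurable_realfun.
From mathcomp Require Import ring lra.

Set Implicit Arguments.
Unset Strict Implicit.
Unset Printing Implicit Defensive.

Import Order.TTheory GRing.Theory Num.Theory.
Import numFieldNormedType.Exports.
Local Open Scope classical_set_scope.
Local Open Scope ring_scope.

(** Write [Phi d sg y] for the integral over [0 <= u < y] of
    [(y - u) ^ (d - 1)] against [sg], called [fractional_integral d sg y] below;
    the function of the theorem is [Phi (1 - eps) mu]. Everything rests on one
    identity on the slit plane,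
      [B * (u + z) ^ - (b - d) =
         integral over y > u of (y - u) ^ (d - 1) * (y + z) ^ - b],
    where [0 < d < b] and [B], the value of the right-hand side for [u = 0] and
    [z = 1], is a finite positive constant ([fractional_integral_phase_power]).
    By Fubini, [B] times the transform of exponent [b - d] of a measure [sg] is
    the integral of [(y + z) ^ - b] against [Phi d sg].

    Suppose that the order of [f] is less than [beta]: then [f] is also the
    transform, for some exponent [a < beta], of a measure [nu]. By the identity
    and the uniqueness of representing measures ([stieltjes_uniqueness]), [mu]
    has the density [Phi (beta - a) nu / B] on the half-line. Hence
    [Phi (1 - eps) mu] is a multiple of the integral of
    [(y - u) ^ (beta - a - eps)] over [u < y] against [nu], which is
    nondecreasing in [y] as soon as [eps <= beta - a]
    ([fractional_integral_homo]).

    Conversely, let [Phi (1 - eps) mu] be nondecreasing, and [a = beta - eps].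
    It is finite, hence almost everywhere equal to the distribution function
    [Phi 1 nu] of a Lebesgue-Stieltjes measure [nu]. For [b = a + 1], the
    identity with [d = 1 - eps] turns the integral of [(y + z) ^ - b] against
    this function into a multiple of the transform of exponent [beta] of [mu];
    with [d = 1], into a multiple of the transform of exponent [a] of [nu]. So a
    multiple of [nu], with the mass of [mu] at infinity, represents [f] with the
    exponent [a] ([measure_of_potential]), and the order of [f] is at most [a].

    Uniqueness: differentiating the transform at [x = 1] on the positive axis
    removes the constant and gives, with [t = 1 / (1 + u)], the moments of
    exponents [b + 1 + n] in [t]. The polynomials [(1 - t ^ k) ^ m], with [m]
    between [k * a ^ k] and [2 * k * a ^ k], tend boundedly to the indicator
    function of [t < 1 / a], so that these moments determine the mass of each
    half-line.

    The identity: on the unit circle [w = exp (i * th)], the derivative in [th]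
    of [s ^ (d - 1) * w ^ (b - d) * (w + s) ^ - b] is the derivative in [s] of a
    function that vanishes at [0] and at infinity, so that its integral over [s]
    does not depend on [th] ([integral_unit_circle]); dilations and translations
    give the other points of the slit plane. *)

(** * Affine changes of variables and densities *)

Definition image_measure d1 d2 (T1 : measurableType d1) (T2 : measurableType d2)
    (R : realType) (mu : {measure set T1 -> \bar R}) (f : T1 -> T2)
    (mf : measurable_fun setT f) : {measure set T2 -> \bar R} :=
  measure_function_pushforward__canonical__measure_function_Measure mu mf.

Section affine_change_of_variables.
Context {R : realType}.
Variables (r u : R).
Hypothesis r_gt0 : 0 < r.
Let phi (s : measurableTypeR R) : measurableTypeR R := r * s + u.

Let mphi : measurable_fun [set: measurableTypeR R] phi.
Proof. by apply: measurable_funD => //; exact: measurable_funM. Qed.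

Let m : {measure set (measurableTypeR R) -> \bar R} :=
  mscale (NngNum (ltW r_gt0)) (image_measure lebesgue_measure mphi).

Lemma lebesgue_affine (A : set (measurableTypeR R)) : measurable A ->
  lebesgue_measure A = (r%:E * lebesgue_measure (phi @^-1` A))%E.
Proof.
move=> mA; have := @lebesgue_measure_unique R m; apply => //= X.
rewrite /m /mscale/= /pushforward.
case/ocitvP => [->|[[a b]/= ab ->]]; first by rewrite preimage_set0 !measure0 mule0.
rewrite (_ : _ @^-1` _ = `](a - u) / r, (b - u) / r]%classic); last first.
  apply/seteqP; split => x /=; rewrite /phi !in_itv /=.
    by rewrite ltr_pdivrMr// ler_pdivlMr// ![x * _]mulrC; lra.
  by rewrite ltr_pdivrMr// ler_pdivlMr// ![x * _]mulrC; lra.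
rewrite !lebesgue_measure_itv/= !lte_fin ltr_pM2r ?invr_gt0// ltrD2r ab.
by rewrite -!EFinB -EFinM; congr EFin; field; rewrite gt_eqF.
Qed.

Lemma ge0_integral_affine (f : R -> \bar R) : measurable_fun setT f ->
    (forall x, 0 <= f x)%E ->
  (\int[lebesgue_measure]_x f x =
   r%:E * \int[lebesgue_measure]_s f (r * s + u)%R)%E.
Proof.
move=> mf f0.
rewrite (@eq_measure_integral _ _ _ _ m); last first.
  by move=> A mA _; exact: lebesgue_affine.
rewrite ge0_integral_mscale//=; congr (_ * _)%E.
by rewrite ge0_integral_pushforward.
Qed.

Lemma integral_affine (f : R -> \bar R) : measurable_fun setT f ->
  (\int[lebesgue_measure]_x f x =
   r%:E * \int[lebesgue_measure]_s f (r * s + u)%R)%E.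
Proof.
move=> mf; rewrite integralE [in RHS]integralE.
rewrite (ge0_integral_affine (measurable_funepos mf))//.
rewrite (ge0_integral_affine (measurable_funeneg mf))//.
have <- : (\int[lebesgue_measure]_s f^\+ (r * s + u)%R =
    \int[lebesgue_measure]_s (fun s => f (r * s + u)%R)^\+ s)%E.
  by apply: eq_integral => s _; rewrite !funeposE.
have <- : (\int[lebesgue_measure]_s f^\- (r * s + u)%R =
    \int[lebesgue_measure]_s (fun s => f (r * s + u)%R)^\- s)%E.
  by apply: eq_integral => s _; rewrite !funenegE.
set a := integral _ _ _; set b := integral _ _ _.
case: a b => [a| |] [b| |]//=; rewrite ?(gt0_muley, gt0_muleNy, gt0_mulye) ?lte_fin//.
by rewrite -[X in (X + _)%E]EFinM -!EFinD -EFinM; congr EFin; ring.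
Qed.

End affine_change_of_variables.

Section density.
Local Open Scope ereal_scope.
Context d (T : measurableType d) (R : realType).
Variables (mu : {measure set T -> \bar R}) (f : T -> \bar R).
Hypotheses (mf : measurable_fun setT f) (f0 : forall x, 0 <= f x).

Let dens (A : set T) := \int[mu]_(x in A) f x.

Let dens0 : dens set0 = 0. Proof. exact: integral_set0. Qed.

Let dens_ge0 A : 0 <= dens A. Proof. exact: integral_ge0. Qed.

Let dens_sigma_additive : semi_sigma_additive dens.
Proof.
move=> F mF tF mUF; rewrite /dens ge0_integral_bigcup//; last first.
  exact: measurable_funTS.
by apply: is_cvg_ereal_nneg_natsum => n _; exact: integral_ge0.
Qed.

HB.instance Definition _ := isMeasure.Build _ _ _ dens dens0 dens_ge0
  dens_sigma_additive.

Import HBNNSimple.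

(** The integrand is approximated from below by simple functions. The density is
    extended-real valued, as a fractional integral may be infinite at some
    points. *)
Lemma density_measure : exists m : {measure set T -> \bar R},
  (forall A, measurable A -> m A = \int[mu]_(x in A) f x) /\
  forall g : T -> \bar R, measurable_fun setT g -> (forall x, 0 <= g x) ->
    \int[m]_x g x = \int[mu]_x (g x * f x).
Proof.
exists dens; split => // g mg g0.
pose h := nnsfun_approx measurableT mg.
have hc x : (h n x)%:E @[n --> \oo] --> g x.
  exact: (cvg_nnsfun_approx measurableT mg).
have hle x : {homo (fun n => (h n x)%:E) : m n / (m <= n)%N >-> m <= n}.
  by move=> m n mn; rewrite lee_fin; exact/lefP/nd_nnsfun_approx.
have hsup x : g x = ereal_sup (range (fun n => (h n x)%:E)).
  by apply: cvg_unique (hc x) _ => //; exact/ereal_nondecreasing_cvgn/hle.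
transitivity (limn (fun n => \int[dens]_x (h n x)%:E)).
  rewrite -monotone_convergence//.
  - by apply: eq_integral => x _; apply/esym/cvg_lim.
  - by move=> n; exact/measurable_EFinP.
  - by move=> n x _; rewrite lee_fin.
transitivity (limn (fun n => \int[mu]_x ((h n x)%:E * f x))); last first.
  rewrite -monotone_convergence//.
  - apply: eq_integral => x _; apply/cvg_lim => //.
    have [fx|] := boolP (f x \is a fin_num); first exact: cvgeZr.
    rewrite fin_numElt (lt_le_trans (ltNyr 0) (f0 x))/= -leNgt leye_eq.
    move=> /eqP ->.
    (* Where the density is infinite, so is the product from the first index
       with [h n x > 0] on; if there is none, [g x] is zero. *)
    have [gx0|gx0] := eqVneq (g x) 0.
      have h0 n : h n x = 0%R.
        apply/eqP; rewrite eq_le fun_ge0 andbT -lee_fin -[leRHS]gx0.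
        by rewrite hsup; apply: ereal_sup_ubound; exists n.
      by under eq_fun do rewrite h0 mul0e; rewrite gx0 mul0e; exact: cvg_cst.
    have gxp : 0 < g x by rewrite lt_neqAle eq_sym gx0 g0.
    rewrite gt0_muley//.
    have [_ [N _ <-] hN] : exists2 y, range (fun n => (h n x)%:E) y & 0 < y.
      by apply: ereal_sup_gt; rewrite -hsup.
    apply: cvg_near_cst; exists N => // n Nn; rewrite gt0_muley//.
    exact: lt_le_trans hN (hle _ _ _ Nn).
  - by move=> n; apply: emeasurable_funM => //; exact/measurable_EFinP.
  - by move=> n x _; rewrite mule_ge0 ?lee_fin.
  - by move=> x _ m n mn; rewrite lee_wpmul2r//; exact: hle.
apply: congr_lim; apply/funext => n.
rewrite integralT_nnsfun sintegralE.
under [RHS]eq_integral => x _.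
  rewrite fimfunE -fsumEFin// ge0_mule_fsuml; last first.
    by move=> y; exact: nnfun_muleindic_ge0.
  over.
rewrite ge0_integral_fsum//; last 2 first.
  - move=> y; apply: emeasurable_funM => //.
    by apply/measurable_EFinP; exact: measurable_funM.
  - by move=> y x _; rewrite mule_ge0// nnfun_muleindic_ge0.
apply: eq_fsbigr => y /[!inE] -[x _ yE].
under [RHS]eq_integral do rewrite EFinM -muleA.
rewrite ge0_integralZl//; last 3 first.
- by apply: emeasurable_funM => //; exact/measurable_EFinP.
- by move=> z _; rewrite mule_ge0 ?lee_fin.
- by rewrite lee_fin -yE.
congr (_ * _); rewrite -[LHS]/(\int[mu]_(x in h n @^-1` [set y]) f x).
rewrite integral_mkcond; apply: eq_integral => z _.
by rewrite epatch_indic muleC.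
Qed.

End density.

(** * Uniqueness of the representing measure *)

Section powers.
Context {R : realType}.
Implicit Types g x y : R.

Lemma le_powRN g x y : 0 <= g -> 0 < x -> x <= y -> y `^ (- g) <= x `^ (- g).
Proof.
move=> g0 x0 xy; have y0 : 0 < y by exact: lt_le_trans xy.
rewrite !powRN lef_pV2 ?posrE ?powR_gt0//.
by apply: ge0_ler_powR; rewrite ?nnegrE// ltW.
Qed.

Lemma measurable_powR_translate x g :
  measurable_fun setT (fun u : measurableTypeR R => (u + x) `^ g).
Proof.
apply: (@measurableT_comp _ _ _ _ _ _ (@powR R ^~ g)).
  exact: measurable_powR.
by apply: measurable_funD.
Qed.

Lemma le_powRN_translate b g x u : 0 < x -> 0 <= u -> b <= g ->
  (u + x) `^ (- g) <= x `^ (b - g) * (u + x) `^ (- b).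
Proof.
move=> x0 u0 bg; have ux0 : 0 < u + x by lra.
have -> : (u + x) `^ (- g) = (u + x) `^ (- (g - b)) * (u + x) `^ (- b).
  by rewrite -powRD ?(gt_eqF ux0) ?implybT//; congr powR; lra.
rewrite ler_wpM2r ?powR_ge0// (_ : b - g = - (g - b)); last by lra.
by apply: le_powRN; lra.
Qed.

End powers.

Section cauchy_moments.
Context {R : realType}.
Local Notation D := (`[0, +oo[%classic : set (measurableTypeR R)).
Implicit Types (sg : {measure set (measurableTypeR R) -> \bar R}).

(** The generalized Stieltjes transform on the positive half-axis. *)
Definition cauchy_moment sg (b x : R) : R :=
  \int[sg]_(u in D) ((u + x) `^ (- b)).

Definition cauchy_integrable sg (b : R) :=
  (\int[sg]_(u in D) ((u + 1) `^ (- b))%:E < +oo)%E.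

Let mD : measurable D. Proof. exact: measurable_itv. Qed.

Lemma integrable_cauchy sg (b g x : R) : 0 <= b -> cauchy_integrable sg b ->
  b <= g -> 0 < x -> sg.-integrable D (EFin \o fun u => (u + x) `^ (- g)).
Proof.
move=> b0 sb bg x0.
have mf y h : measurable_fun D (EFin \o fun u : measurableTypeR R => (u + y) `^ h).
  apply/measurable_EFinP; apply: measurable_funTS; exact: measurable_powR_translate.
have i1 : sg.-integrable D (EFin \o fun u => (u + 1) `^ (- b)).
  apply/integrableP; split; first exact: mf.
  move: sb; rewrite /cauchy_integrable; apply: le_lt_trans.
  rewrite le_eqVlt; apply/orP; left; apply/eqP; apply: eq_integral => u _ /=.
  by rewrite ger0_norm ?powR_ge0.
(* [u + x >= min 1 x * (u + 1)] moves the base point [x] to [1]. *)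
pose c := x `^ (b - g) * (Num.min 1 x) `^ (- b).
have i2 : sg.-integrable D (EFin \o fun u => c * (u + 1) `^ (- b)).
  rewrite (_ : _ \o _ = fun u => c%:E * ((u + 1) `^ (- b))%:E)%E.
    exact: integrableZl.
  by apply/funext => u /=; rewrite EFinM.
apply: le_integrable i2 => //= u; rewrite in_itv/= andbT => u0.
rewrite lee_fin !ger0_norm ?powR_ge0 ?mulr_ge0 ?powR_ge0//.
apply: le_trans (le_powRN_translate x0 u0 bg) _.
rewrite -mulrA; apply: ler_wpM2l; first exact: powR_ge0.
have m0 : 0 < Num.min 1 x by rewrite lt_min ltr01.
rewrite -powRM; [|exact: ltW|by lra].
apply: le_powRN => //; first by rewrite mulr_gt0//; lra.
have : Num.min 1 x <= 1 by rewrite ge_min lexx.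
have : Num.min 1 x <= x by rewrite ge_min lexx orbT.
by nra.
Qed.

(** On [x > a / 2] the [x]-derivative of the integrand is dominated by its
    value at [a / 2]. *)
Lemma cvg_cauchy_moment_derivative sg (b a : R) : 0 <= b -> cauchy_integrable sg b ->
  0 < a ->
  h^-1 *: (cauchy_moment sg b (h + a) - cauchy_moment sg b a) @[h --> 0^'] -->
  - b * cauchy_moment sg (b + 1) a.
Proof.
move=> b0 sb a0.
pose f (x : R) (u : measurableTypeR R) := (u + x) `^ (- b).
have df (x u : R) : 0 < x -> 0 <= u ->
    is_derive x 1 (f ^~ u) (- b * (u + x) `^ (- b - 1)).
  move=> x0 u0; have ux : 0 < u + x by lra.
  have := @is_derive1_comp _ (@powR R ^~ (- b)) (fun t => u + t) x _ _
    (is_derive1_powR (- b) ux) (is_deriveD (is_derive_cst u x 1) (is_derive_id x 1)).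
  by rewrite add0r mulr1.
have p1 (x u : R) : 0 < x -> 0 <= u -> partial1of2 f x u = - b * (u + x) `^ (- (b + 1)).
  move=> x0 u0; rewrite /partial1of2 derive1E (@derive_val _ _ _ _ _ _ _ (df _ _ x0 u0)).
  by rewrite opprD.
have aI : `](a / 2), (2 * a)[%classic a by rewrite /= in_itv/=; lra.
have I0 (x : R) : `](a / 2), (2 * a)[%classic x -> a / 2 < x /\ 0 < x.
  by rewrite /= in_itv/=; lra.
have a2 : 0 < a / 2 by lra.
have := @cvg_differentiation_under_integral _ _ _ sg f D mD a _ _ aI _ _
  (fun u => b * (u + a / 2) `^ (- (b + 1))).
have -> : \int[sg]_(y in D) partial1of2 f a y = - b * cauchy_moment sg (b + 1) a.
  rewrite /cauchy_moment -RintegralZl//; last first.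
    by apply: integrable_cauchy sb _ _ => //; lra.
  by apply: eq_Rintegral => u /[!inE]/=; rewrite in_itv/= andbT => u0; rewrite p1.
apply.
- by move=> x /I0[_ x0]; exact: integrable_cauchy sb _ _.
- move=> x u /I0[_ x0] /=; rewrite in_itv/= andbT => u0.
  by have /@ex_derive := df _ _ x0 u0.
- by move=> u; rewrite mulr_ge0// powR_ge0.
- rewrite (_ : _ \o _ = fun u => b%:E * ((u + a / 2) `^ (- (b + 1)))%:E)%E.
    by apply: integrableZl => //; apply: integrable_cauchy sb _ _ => //; lra.
  by apply/funext => u /=; rewrite EFinM.
- move=> x u /I0[ax x0] /=; rewrite in_itv/= andbT => u0.
  rewrite p1// mulNr normrN ger0_norm ?mulr_ge0 ?powR_ge0// ler_wpM2l//.
  by apply: le_powRN; lra.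
Qed.

Lemma cauchy_moment_shift_exponent sg1 sg2 (b c : R) : 0 < b ->
  cauchy_integrable sg1 b -> cauchy_integrable sg2 b ->
  (forall x, 0 < x -> cauchy_moment sg1 b x = cauchy_moment sg2 b x + c) ->
  forall x, 0 < x -> cauchy_moment sg1 (b + 1) x = cauchy_moment sg2 (b + 1) x.
Proof.
move=> b0 s1 s2 e12 a a0.
have h1 := cvg_cauchy_moment_derivative (ltW b0) s1 a0.
have h2 := cvg_cauchy_moment_derivative (ltW b0) s2 a0.
apply: (@mulfI _ (- b)); first by rewrite oppr_eq0 gt_eqF.
apply: cvg_unique h2 => //.
apply: cvg_trans h1; apply: near_eq_cvg.
near=> h; rewrite !e12//; first by congr (_ *: _); ring.
suff : - a < h by lra.
near: h; apply: nbhs_dnbhs; apply: lt_nbhsr; lra.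
Unshelve. all: end_near. Qed.

End cauchy_moments.

Section indicator_approximation.
Context {R : realType}.
Implicit Types (x t a : R) (m k : nat).

Lemma bernoulli_lower x m : 0 <= x <= 1 -> 1 - m%:R * x <= (1 - x) ^+ m.
Proof.
move=> x01; elim: m => [|m ih]; first by rewrite mul0r subr0 expr0.
rewrite exprS -natr1 mulrDl mul1r.
have : (1 - x) * (1 - m%:R * x) <= (1 - x) * (1 - x) ^+ m.
  by apply: ler_wpM2l => //; lra.
by have : 0 <= m%:R :> R by []; nra.
Qed.

Lemma bernoulli_upper x m : 0 <= x <= 1 -> (1 + m%:R * x) * (1 - x) ^+ m <= 1.
Proof.
move=> x01; elim: m => [|m ih]; first by rewrite mul0r addr0 expr0 mulr1.
apply: le_trans ih; rewrite exprS -natr1.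
have h : 0 <= (1 - x) ^+ m by apply: exprn_ge0; lra.
rewrite mulrA; apply: ler_wpM2r => //.
by have : 0 <= m%:R :> R by []; nra.
Qed.

(** For [a >= 1] this lies between [k * a ^ k] and [2 * k * a ^ k]. *)
Definition indicator_exponent a k : nat := (k * (Num.truncn (a ^+ k)).+1)%N.

(** If [m] is the exponent, [m * t ^ k] is at most [2 * k * (a * t) ^ k], which
    tends to [0] when [a * t < 1], and is at least [k] otherwise; Bernoulli's
    inequality concludes in both cases. *)
Lemma cvg_indicator_approximation a t : 1 <= a -> 0 <= t <= 1 ->
  (1 - t ^+ k) ^+ indicator_exponent a k @[k --> \oo] -->
  ((if a * t < 1 then 1 else 0) : R).
Proof.
move=> a1 t01.
have tk k : 0 <= t ^+ k <= 1.
  by rewrite exprn_ge0 ?exprn_ile1//; lra.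
have a0 : 0 <= a by lra.
have MP k : a ^+ k <= (Num.truncn (a ^+ k)).+1%:R <= 2 * a ^+ k.
  have ak1 : 1 <= a ^+ k by exact: exprn_ege1.
  have /andP[h1 h2] : (Num.truncn (a ^+ k))%:R <= a ^+ k < (Num.truncn (a ^+ k)).+1%:R.
    by apply: truncn_itv; lra.
  by move: h1 h2; rewrite -natr1; lra.
case: ifPn => [at1|]; last rewrite -leNgt => at1.
- pose q := a * t.
  have q0 : 0 <= q by rewrite /q; apply: mulr_ge0; lra.
  have [q1|q1] := eqVneq q 0.
    have t0 : t = 0 by move: q1 => /eqP; rewrite mulf_eq0 => /orP[/eqP|/eqP]; lra.
    apply: cvg_near_cst; exists 1%N => // k /= k1.
    by rewrite t0 expr0n; case: k k1 => //= k _; rewrite subr0 expr1n.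
  (* [k * q ^ k] tends to zero: [k * r ^ k] is bounded for [r = sqrt q]. *)
  pose r := Num.sqrt q.
  have r2 : r ^+ 2 = q by rewrite /r sqr_sqrtr.
  have r0 : 0 <= r by exact: sqrtr_ge0.
  have r1 : r < 1 by have := at1; rewrite -/q -r2; nra.
  have kr k : k%:R * r ^+ k <= (1 - r)^-1.
    have := @bernoulli_upper (1 - r) k; rewrite (_ : 1 - (1 - r) = r); last by lra.
    have rk0 : 0 <= r ^+ k by exact: exprn_ge0.
    move=> /(_ ltac:(lra)) h; rewrite -[leRHS]mul1r ler_pdivlMr; last by lra.
    by nra.
  apply: (@squeeze_cvgr _ _ _ _ (fun k => 1 - 2 * (1 - r)^-1 * r ^+ k) (cst 1)).
  + apply: nearW => k; apply/andP; split; last first.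
      by apply: exprn_ile1; have := tk k; lra.
    apply: le_trans (bernoulli_lower _ (tk k)); rewrite lerD2l lerN2.
    rewrite /indicator_exponent natrM.
    have /andP[_ h] := MP k.
    apply: (@le_trans _ _ (2 * (k%:R * r ^+ k) * r ^+ k)); last first.
      rewrite ler_wpM2r ?exprn_ge0// ler_wpM2l//.
    have -> : 2 * (k%:R * r ^+ k) * r ^+ k = k%:R * (2 * a ^+ k) * t ^+ k.
      have -> : 2 * (k%:R * r ^+ k) * r ^+ k = 2 * k%:R * (r ^+ 2) ^+ k.
        by rewrite -exprM mulnC exprM expr2; ring.
      by rewrite r2 /q exprMn; ring.
    rewrite ler_wpM2r//; first by have /andP[] := tk k.
    by rewrite ler_wpM2l.
  + rewrite -[X in _ --> X]subr0; apply: cvgB; first exact: cvg_cst.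
    by apply: (cvg_geometric (2 * (1 - r)^-1)); rewrite ger0_norm.
  + exact: cvg_cst.
- apply: (@squeeze_cvgr _ _ _ _ (cst 0) (@harmonic R)).
  + apply: nearW => k; apply/andP; split.
      by apply: exprn_ge0; have := tk k; lra.
    rewrite /harmonic -[leRHS]mul1r ler_pdivlMr// mulrC.
    apply: le_trans (@bernoulli_upper (t ^+ k) (indicator_exponent a k) (tk k)).
    apply: ler_wpM2r; first by apply: exprn_ge0; have := tk k; lra.
    rewrite -natr1 addrC lerD2l /indicator_exponent natrM -mulrA.
    have /andP[h _] := MP k.
    rewrite ler_peMr//; apply: (@le_trans _ _ (a ^+ k * t ^+ k)).
      by rewrite -exprMn exprn_ege1.
    by rewrite ler_wpM2r//; have /andP[] := tk k.
  + exact: cvg_cst.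
  + exact: cvg_harmonic.
Qed.

End indicator_approximation.

Section moment_problem.
Context {R : realType}.
Local Notation D := (`[0, +oo[%classic : set (measurableTypeR R)).
Variables (sg1 sg2 : {measure set (measurableTypeR R) -> \bar R}) (b0 : R).
Hypotheses (b0_gt0 : 0 < b0).
Hypotheses (int1 : cauchy_integrable sg1 b0) (int2 : cauchy_integrable sg2 b0).
Hypothesis moments : forall n, cauchy_moment sg1 (b0 + n%:R) 1 =
                               cauchy_moment sg2 (b0 + n%:R) 1.

Let mD : measurable D. Proof. exact: measurable_itv. Qed.

Let w (u : R) := (u + 1) `^ (- b0).
Let t (u : R) := (u + 1)^-1.

Let w0 u : 0 <= w u. Proof. exact: powR_ge0. Qed.

Let t01 u : D u -> 0 <= t u <= 1.
Proof.
rewrite /= in_itv/= andbT => u0; rewrite /t invr_ge0 invf_le1; lra.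
Qed.

Let mw : measurable_fun setT (w : measurableTypeR R -> R).
Proof. exact: measurable_powR_translate. Qed.

Let mt : measurable_fun D (t : measurableTypeR R -> R).
Proof.
apply: (eq_measurable_fun (fun u : measurableTypeR R => (u + 1) `^ (-1))).
  move=> u /[!inE]/=; rewrite in_itv/= andbT => u0.
  by rewrite powR_inv1//; lra.
by apply: measurable_funTS; exact: measurable_powR_translate.
Qed.

Let polynomial_weight (n m k : nat) u := w u * (t u ^+ n * (1 - t u ^+ k) ^+ m).

Let pw_bound n m k u : D u ->
  `|polynomial_weight n m k u| <= w u.
Proof.
move=> Du; have /andP[t0 t1] := t01 Du.
have h k' : 0 <= t u ^+ k' <= 1 by rewrite exprn_ge0 ?exprn_ile1.
rewrite ger0_norm; last first.
  by rewrite !mulr_ge0 ?exprn_ge0//; have := h k; lra.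
rewrite ler_piMr// mulr_ile1 ?exprn_ge0 ?exprn_ile1//; have := h k; lra.
Qed.

Let mpw n m k : measurable_fun D (polynomial_weight n m k : measurableTypeR R -> R).
Proof.
apply: measurable_funM; first exact: measurable_funTS.
apply: measurable_funM; first exact: measurable_funX.
by apply: measurable_funX; apply: measurable_funB => //; exact: measurable_funX.
Qed.

Let intw sg : cauchy_integrable sg b0 -> sg.-integrable D (EFin \o w).
Proof. by move=> i; exact: integrable_cauchy (ltW b0_gt0) i _ _. Qed.

Let intpw sg n m k : cauchy_integrable sg b0 ->
  sg.-integrable D (EFin \o polynomial_weight n m k).
Proof.
move=> i; apply: le_integrable (intw i) => //; first exact/measurable_EFinP.
by move=> u Du /=; rewrite lee_fin (ger0_norm (w0 u)) pw_bound.
Qed.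

Let polynomial_moments n m k :
  \int[sg1]_(u in D) polynomial_weight n m k u =
  \int[sg2]_(u in D) polynomial_weight n m k u.
Proof.
elim: m n => [|m ih] n.
  have e (sg : {measure set (measurableTypeR R) -> \bar R}) :
      \int[sg]_(u in D) polynomial_weight n 0 k u = cauchy_moment sg (b0 + n%:R) 1.
    apply: eq_Rintegral => u /[!inE]/=; rewrite in_itv/= andbT => u0.
    rewrite /polynomial_weight expr0 mulr1 opprD powRD; last first.
      by rewrite (gt_eqF (_ : 0 < u + 1)) ?implybT//; lra.
    rewrite (powRN _ n%:R) powR_mulrn; last by lra.
    by rewrite /t exprVn.
  by rewrite !e.
have e (sg : {measure set (measurableTypeR R) -> \bar R}) : cauchy_integrable sg b0 ->
    \int[sg]_(u in D) polynomial_weight n m.+1 k u =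
    \int[sg]_(u in D) polynomial_weight n m k u -
    \int[sg]_(u in D) polynomial_weight (n + k) m k u.
  move=> i; rewrite -RintegralB//; [|exact: intpw..].
  apply: eq_Rintegral => u _.
  by rewrite /polynomial_weight exprD exprS; ring.
by rewrite !e// !ih.
Qed.

Let step_moments a : 1 <= a ->
  (\int[sg1]_(u in D) (w u * (if a * t u < 1 then 1 else 0))%:E =
   \int[sg2]_(u in D) (w u * (if a * t u < 1 then 1 else 0))%:E)%E.
Proof.
move=> a1.
have lim (sg : {measure set (measurableTypeR R) -> \bar R}) : cauchy_integrable sg b0 ->
    (\int[sg]_(u in D) (polynomial_weight 0 (indicator_exponent a k) k u)%:E
      @[k --> \oo] -->
     \int[sg]_(u in D) (w u * (if a * t u < 1 then 1 else 0))%:E)%E.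
  move=> i; apply: (@dominated_cvg _ _ _ _ _ mD
    (fun k u => (polynomial_weight 0 (indicator_exponent a k) k u)%:E) _ (EFin \o w)) => //.
  - by move=> k; exact/measurable_EFinP.
  - move=> u Du; apply: cvg_EFin; first exact: nearW.
    rewrite /polynomial_weight /comp/=.
    under eq_fun do rewrite expr0 mul1r.
    apply: cvgMr; apply: cvg_indicator_approximation => //; exact: t01.
  - exact: intw.
  - by move=> k u Du; rewrite lee_fin pw_bound.
apply: cvg_unique (lim _ int1) _ => //.
have := lim _ int2; apply: cvg_trans; apply: near_eq_cvg; near=> k.
have fK (sg : {measure set (measurableTypeR R) -> \bar R}) n m : cauchy_integrable sg b0 ->
    (\int[sg]_(u in D) (polynomial_weight n m k u)%:E =
     (\int[sg]_(u in D) polynomial_weight n m k u)%R%:E)%E.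
  move=> i; rewrite fineK//; apply: integrable_fin_num => //; exact: intpw.
by rewrite !fK// polynomial_moments.
Unshelve. all: end_near. Qed.

Let wD u : \bar R := (w u * \1_D u)%:E.

Let mwD : measurable_fun setT (wD : measurableTypeR R -> \bar R).
Proof. by apply/measurable_EFinP; exact: measurable_funM. Qed.

Let wD0 u : (0 <= wD u)%E. Proof. by rewrite lee_fin mulr_ge0. Qed.

(* The step functions of [step_moments] jump at points [u >= 0]. For [c < 0] the
   half-line also contains the origin, the only point of [D] with [t >= 1]. *)
Let integral_wD (sg : {measure set (measurableTypeR R) -> \bar R}) c :
  (\int[sg]_(u in `]c, +oo[) wD u =
   \int[sg]_(u in D) (w u * (if Num.max 1 (c + 1) * t u < 1 then 1 else 0))%:E +
   \int[sg]_(u in D) (w u * (if c < 0 then (if t u < 1 then 0 else 1) else 0))%:E)%E.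
Proof.
rewrite -ge0_integralD//; last 4 first.
- by move=> u _; rewrite lee_fin; apply: mulr_ge0 => //; case: ifP.
- apply/measurable_EFinP; apply: measurable_funM; first exact: measurable_funTS.
  apply: measurable_fun_if => //; apply: measurable_fun_ltr => //.
  exact: measurable_funM.
- by move=> u _; rewrite lee_fin; apply: mulr_ge0 => //; case: ifP => // _; case: ifP.
- apply/measurable_EFinP; apply: measurable_funM; first exact: measurable_funTS.
  case: (ltP c 0) => // _.
  by apply: measurable_fun_if => //; exact: measurable_fun_ltr.
rewrite [LHS]integral_mkcond [RHS]integral_mkcond.
refine (@eq_integral _ _ _ sg _ _ _ (fun (u : R) _ => _)).
rewrite /patch /wD indicE.
have [uD|uD] := boolP (u \in D); last by rewrite mulr0; case: ifP.
have u0 : 0 <= u by move: uD; rewrite inE/= in_itv/= andbT.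
rewrite mulr1 -EFinD -mulrDr.
have tE y : y * t u < 1 = (y < u + 1) by rewrite ltr_pdivrMr ?mul1r//; lra.
rewrite tE -[t u]mul1r tE.
have -> : (u \in `]c, +oo[%classic) = (c < u).
  by apply/idP/idP; rewrite inE/= in_itv/= andbT.
have [cu|cu] := ltP c u; case: (ltP c 0) => c0; rewrite ?gt_max.
- have [|u1] := ltP 1 (u + 1); first by rewrite ?ltrD2r cu /= addr0 mulr1.
  by rewrite /= add0r mulr1.
- by rewrite ltrD2r cu (_ : 1 < u + 1) ?addr0 ?mulr1//; lra.
- by exfalso; lra.
- by rewrite ltrD2r [c < u]ltNge cu andbF addr0 mulr0.
Qed.

(** The weight [(u + 1) ^ - b0] makes the measures finite, and the moments
    determine the weighted mass of each half-line, hence of each Borel set. *)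
Lemma cauchy_moments_determine (g : R -> \bar R) : measurable_fun setT g ->
  (forall u, 0 <= g u)%E -> (\int[sg1]_(u in D) g u = \int[sg2]_(u in D) g u)%E.
Proof.
move=> mg g0.
have [m1 [m1E m1int]] := density_measure sg1 mwD wD0.
have [m2 [m2E m2int]] := density_measure sg2 mwD wD0.
have hw u : D u -> 0 < w u by rewrite /= in_itv/= andbT => u0; apply: powR_gt0; lra.
pose h u : \bar R := (g u * ((u + 1) `^ b0 * \1_D u)%:E)%E.
have mh : measurable_fun setT (h : measurableTypeR R -> \bar R).
  apply: emeasurable_funM => //; apply/measurable_EFinP.
  by apply: measurable_funM => //; exact: measurable_powR_translate.
have h0 u : (0 <= h u)%E by rewrite mule_ge0// lee_fin mulr_ge0// powR_ge0.
have hE (sg : {measure set (measurableTypeR R) -> \bar R}) :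
    (\int[sg]_(u in D) g u = \int[sg]_u (h u * wD u))%E.
  rewrite integral_mkcond; apply: eq_integral => u _.
  rewrite patchE /h /wD indicE; case: ifPn => uD; last by rewrite !mulr0 !mule0.
  rewrite -muleA -EFinM !mulr1 -powRD ?addrN ?powRr0 ?mule1//.
  move: uD; rewrite inE/= in_itv/= andbT => u0.
  by rewrite (gt_eqF (_ : 0 < u + 1)) ?implybT//; lra.
rewrite !hE -m1int// -m2int//.
apply: eq_measure_integral => A mA _.
have mE c : m1 `]c, +oo[%classic = m2 `]c, +oo[%classic.
  rewrite m1E// m2E// !integral_wD step_moments; last by rewrite le_max lexx.
  congr (_ + _)%E; case: (ltP c 0) => c0; last first.
    by rewrite !integral0_eq// => u _; rewrite mulr0.
  (* The weighted mass of the origin: the total mass minus that of [t < 1]. *)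
  have e (sg : {measure set (measurableTypeR R) -> \bar R}) : cauchy_integrable sg b0 ->
    (\int[sg]_(u in D) (w u * (if t u < 1 then 0 else 1))%:E =
     (\int[sg]_(u in D) polynomial_weight 0 0 0 u)%R%:E -
     \int[sg]_(u in D) (w u * (if 1 * t u < 1 then 1 else 0))%:E)%E.
    move=> i; rewrite -[X in (X - _)%E]fineK; last first.
      by rewrite /Rintegral.
    rewrite fineK// /Rintegral fineK; last by apply: integrable_fin_num => //; exact: intpw.
    rewrite -integralB//; [|exact: intpw|].
      apply: eq_integral => u _; rewrite -EFinB /polynomial_weight !expr0 mul1r mulr1.
      by rewrite mul1r; case: ifP => _; congr EFin; ring.
    apply: le_integrable (intw i) => //.
      apply/measurable_EFinP; apply: measurable_funM; first exact: measurable_funTS.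
      apply: measurable_fun_if => //; apply: measurable_fun_ltr => //.
      exact: measurable_funM.
    move=> u Du /=; rewrite lee_fin normrM !ger0_norm//; last by case: ifP.
    by rewrite ler_piMr//; case: ifP.
  by rewrite !e// polynomial_moments step_moments.
apply: (@measure_unique _ R (measurableTypeR R) (@RGenOInfty.G R)
  (fun k => `]- k%:R, +oo[%classic)) => //.
- exact: RGenOInfty.measurableE.
- move=> _ _ [x ->] [y ->]; exists (Num.max x y).
  by apply/seteqP; split => z /=; rewrite !in_itv/= !andbT gt_max;
    [move=> [-> ->]|move=> /andP[]].
- by move=> k; exists (- k%:R).
- rewrite -subTset => x _ /=; exists (Num.truncn `|x|).+1 => //=.
  rewrite in_itv/= andbT ltrNl.
  by rewrite (le_lt_trans (ler_norm _))// normrN truncnS_gt.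
- by move=> _ [x ->].
- move=> k; rewrite m1E//; apply: le_lt_trans (_ : \int[sg1]_(u in D) (w u)%:E < +oo)%E.
    rewrite integral_mkcond [leRHS]integral_mkcond.
    apply: ge0_le_integral => //.
    + by move=> u _; rewrite patchE; case: ifP.
    + by apply/(measurable_restrictT _ _).1 => //; exact: measurable_funTS.
    + apply/(measurable_restrictT _ _).1 => //; apply/measurable_EFinP.
      exact: measurable_funTS.
    + move=> u _; rewrite /patch /wD indicE; case: ifP => _.
        by case: ifP => _; rewrite ?mulr1 ?mulr0.
      by case: ifP => _; rewrite ?lee_fin.
  exact: int1.
Qed.

End moment_problem.

(** Each differentiation in [x] raises the exponent by one, and the first one
    removes the constant; the derivatives at [x = 1] are moments. *)
Lemma stieltjes_uniqueness {R : realType}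
    (sg1 sg2 : {measure set (measurableTypeR R) -> \bar R}) (b c : R) : 0 < b ->
    cauchy_integrable sg1 b -> cauchy_integrable sg2 b ->
    (forall x, 0 < x -> cauchy_moment sg1 b x = cauchy_moment sg2 b x + c) ->
  forall g : R -> \bar R, measurable_fun setT g -> (forall u, 0 <= g u)%E ->
  (\int[sg1]_(u in `[0%R, +oo[) g u = \int[sg2]_(u in `[0%R, +oo[) g u)%E.
Proof.
move=> b0 i1 i2 e12.
have up (sg : {measure set (measurableTypeR R) -> \bar R}) (n : nat) :
    cauchy_integrable sg b -> cauchy_integrable sg (b + n%:R).
  move=> i; have bn : b <= b + n%:R by rewrite lerDl.
  have := integrable_cauchy (ltW b0) i bn ltr01.
  move=> /integrableP[_]; apply: le_lt_trans.
  rewrite /cauchy_integrable le_eqVlt; apply/orP; left; apply/eqP.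
  by apply: eq_integral => u _ /=; rewrite ger0_norm ?powR_ge0.
have main n x : 0 < x -> cauchy_moment sg1 (b + n.+1%:R) x =
                         cauchy_moment sg2 (b + n.+1%:R) x.
  elim: n x => [|n ih] x x0; first exact: cauchy_moment_shift_exponent e12 _ _.
  rewrite -[n.+2%:R]natr1 addrA.
  apply: (@cauchy_moment_shift_exponent _ sg1 sg2 (b + n.+1%:R) 0) => //.
  - by apply: addr_gt0.
  - exact: up.
  - exact: up.
  - by move=> y y0; rewrite addr0 ih.
apply: (@cauchy_moments_determine _ sg1 sg2 (b + 1)).
- by apply: addr_gt0.
- exact: (up _ 1%N).
- exact: (up _ 1%N).
- by move=> n; rewrite -addrA nat1r; exact: main.
Qed.

(** * Fractional integrals of measures *)

Section fractional_integral.
Context {R : realType}.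
Local Notation leb := (@lebesgue_measure R).
Local Notation D := (`[0, +oo[%classic : set (measurableTypeR R)).

(** The value [0] for [s <= 0] lets the integrals of [fractional_kernel d (y - u)]
    in [u] or in [y] range over a fixed domain. *)
Definition fractional_kernel (d s : R) : R := if 0 < s then s `^ (d - 1) else 0.

(** The Riemann-Liouville integral of order [d], without its factor
    [1 / Gamma d]; for [d = 1] it is the distribution function of [sg]. *)
Definition fractional_integral (d : R)
    (sg : {measure set (measurableTypeR R) -> \bar R}) (y : R) : \bar R :=
  (\int[sg]_(u in D) (fractional_kernel d (y - u))%:E)%E.

Lemma fractional_kernel_ge0 d s : 0 <= fractional_kernel d s.
Proof. by rewrite /fractional_kernel; case: ifP => // _; exact: powR_ge0. Qed.

Lemma measurable_fractional_kernel d :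
  measurable_fun setT (fractional_kernel d : measurableTypeR R -> R).
Proof.
apply: measurable_fun_ifT => //; first exact: measurable_fun_ltr.
Qed.

Lemma fractional_integral_ge0 d sg y : (0 <= fractional_integral d sg y)%E.
Proof. by apply: integral_ge0 => u _; rewrite lee_fin fractional_kernel_ge0. Qed.

Lemma fractional_integral_nonpos d sg y : y <= 0 -> fractional_integral d sg y = 0%E.
Proof.
move=> y0; apply: integral0_eq => u; rewrite /= in_itv/= andbT => u0.
by rewrite /fractional_kernel ifF//; apply/negbTE; rewrite -leNgt; lra.
Qed.

Variables (sg : {sigma_finite_measure set (measurableTypeR R) -> \bar R}) (d : R).

Let mD : measurable D. Proof. exact: measurable_itv. Qed.

Let restricted_kernel (z : measurableTypeR R * measurableTypeR R) : R :=
  \1_D z.1 * fractional_kernel d (z.2 - z.1).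

Let restricted_kernel_ge0 z : 0 <= restricted_kernel z.
Proof. by rewrite mulr_ge0// fractional_kernel_ge0. Qed.

Let measurable_restricted_kernel : measurable_fun setT restricted_kernel.
Proof.
apply: measurable_funM; first exact: measurableT_comp.
apply: (measurableT_comp (measurable_fractional_kernel d)).
exact: measurable_funB.
Qed.

Let fractional_integralE y :
  fractional_integral d sg y = (\int[sg]_u (restricted_kernel (u, y))%:E)%E.
Proof.
rewrite /fractional_integral integral_mkcond; apply: eq_integral => u _.
by rewrite patchE /restricted_kernel/= indicE; case: ifP => _; rewrite ?mul1r ?mul0r.
Qed.

Lemma measurable_fractional_integral :
  measurable_fun setT (fractional_integral d sg : measurableTypeR R -> \bar R).
Proof.
rewrite (_ : fractional_integral d sg = fubini_G sg (EFin \o restricted_kernel)).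
  apply: measurable_fun_fubini_tonelli_G; first exact/measurable_EFinP.
  by move=> z /=; rewrite lee_fin.
by apply/funext => y; exact: fractional_integralE.
Qed.

Let integrand (k : R -> R) (z : measurableTypeR R * measurableTypeR R) : \bar R :=
  (restricted_kernel z * k z.2)%:E.

Let measurable_integrand k : measurable_fun setT (k : measurableTypeR R -> R) ->
  measurable_fun setT (integrand k).
Proof.
move=> mk; apply/measurable_EFinP; apply: measurable_funM => //.
exact: (measurableT_comp mk).
Qed.

Let integrand_inner k u :
  (\int[leb]_y integrand k (u, y) =
   ((fun u => \int[leb]_y (fractional_kernel d (y - u) * k y)%:E) \_ D) u)%E.
Proof.
rewrite patchE; case: ifPn => uD.
  by apply: eq_integral => y _; rewrite /integrand/restricted_kernel/= indicE uD mul1r.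
apply: integral0_eq => y _.
by rewrite /integrand/restricted_kernel/= indicE (negbTE uD) !mul0r.
Qed.

(* Although the fractional integral may be infinite, a constant of any sign
   can be taken out of the integral of a nonnegative function. *)
Let integrand_outer k y :
  (\int[sg]_u integrand k (u, y) = (k y)%:E * fractional_integral d sg y)%E.
Proof.
have mK : measurable_fun setT (fun u => (restricted_kernel (u, y))%:E).
  apply/measurable_EFinP.
  exact: (measurableT_comp measurable_restricted_kernel).
have gen c (c0 : 0 <= c) : (\int[sg]_u (restricted_kernel (u, y) * c)%:E =
    c%:E * fractional_integral d sg y)%E.
  rewrite fractional_integralE -ge0_integralZl//; last first.
    by move=> u _; rewrite lee_fin.
  by apply: eq_integral => u _; rewrite -EFinM mulrC.
have [k0|/ltW k0] := leP 0 (k y); first by rewrite -(gen _ k0).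
have := gen (- k y); rewrite oppr_ge0 => /(_ k0).
rewrite (_ : (k y)%:E = - (- k y)%:E)%E; last by rewrite -EFinN opprK.
rewrite mulNe => <-; rewrite -integral_ge0N; last first.
  by move=> u _; rewrite lee_fin mulr_ge0// oppr_ge0.
by apply: eq_integral => u _; rewrite -EFinN mulrN opprK.
Qed.

Lemma tonelli_fractional_integral (k : R -> R) :
    measurable_fun setT (k : measurableTypeR R -> R) -> (forall y, 0 <= k y) ->
  (\int[sg]_(u in D) \int[leb]_y (fractional_kernel d (y - u) * k y)%:E =
   \int[leb]_y ((k y)%:E * fractional_integral d sg y))%E.
Proof.
move=> mk k0; rewrite integral_mkcond.
under eq_integral do rewrite -integrand_inner.
rewrite (@fubini_tonelli _ _ _ _ _ sg leb (integrand k)).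
- by apply: eq_integral => y _; exact: integrand_outer.
- exact: measurable_integrand.
- by move=> z; rewrite lee_fin mulr_ge0.
Qed.

Lemma fubini_fractional_integral (k : R -> R) :
    measurable_fun setT (k : measurableTypeR R -> R) ->
    (\int[sg]_(u in D) \int[leb]_y (fractional_kernel d (y - u) * `|k y|)%:E < +oo)%E ->
  (\int[sg]_(u in D) \int[leb]_y (fractional_kernel d (y - u) * k y)%:E =
   \int[leb]_y ((k y)%:E * fractional_integral d sg y))%E.
Proof.
move=> mk intk; rewrite integral_mkcond.
under eq_integral do rewrite -integrand_inner.
rewrite (@Fubini _ _ _ _ _ sg leb (integrand k)).
  by apply: eq_integral => y _; exact: integrand_outer.
apply/integrable12ltyP; first exact: measurable_integrand.
move: intk; rewrite integral_mkcond.
under eq_integral do rewrite -(integrand_inner (fun y => `|k y|)).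
apply: le_lt_trans; rewrite le_eqVlt; apply/orP; left; apply/eqP.
apply: eq_integral => u _; apply: eq_integral => y _.
by rewrite /integrand abse_EFin normrM ger0_norm.
Qed.

End fractional_integral.

(** * Improper integrals over the half-line *)

Section improper_integrals.
Context {R : realType}.
Local Notation leb := (@lebesgue_measure R).
Local Notation H := (`]0, +oo[%classic : set (measurableTypeR R)).
Variables F f : R -> R.
Hypothesis dF : forall s : R, 0 < s -> is_derive s 1 F (f s).
Hypothesis cf : {in `]0, +oo[, continuous f}.

(* From [n + 2] on, the two ends are distinct. *)
Let E (n : nat) : set (measurableTypeR R) := `[n.+2%:R^-1, n.+2%:R]%classic.

Let n2 n : 0 < n.+2%:R^-1 :> R /\ n.+2%:R^-1 < n.+2%:R :> R.
Proof.
have h : 2 <= n.+2%:R :> R by rewrite ler_nat.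
split; first by rewrite invr_gt0; lra.
apply: (lt_le_trans _ h); apply: (@lt_trans _ _ 1); last by lra.
by rewrite invf_lt1 ?posrE; lra.
Qed.

Let EH n : E n `<=` H.
Proof.
move=> x; rewrite /E /= !in_itv/= andbT => /andP[h _].
exact: lt_le_trans (n2 n).1 h.
Qed.

Let mE n : measurable (E n). Proof. exact: measurable_itv. Qed.

Let ndE : {homo E : n m / (n <= m)%N >-> (n <= m)%O}.
Proof.
move=> n m nm; rewrite subsetEset => x; rewrite /E /= !in_itv/= => /andP[h1 h2].
apply/andP; split.
  by apply: le_trans h1; rewrite lef_pV2 ?posrE// ler_nat.
by apply: le_trans h2 _; rewrite ler_nat.
Qed.

Let EU : \bigcup_n E n = H.
Proof.
apply/seteqP; split => x; first by move=> [n _ /EH].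
rewrite /= in_itv/= andbT => x0.
pose n := maxn (Num.truncn x) (Num.truncn x^-1).
exists n => //; rewrite /E /= in_itv/=; apply/andP; split.
  rewrite -[leRHS]invrK lef_pV2 ?posrE ?invr_gt0//.
  apply: ltW; apply: lt_le_trans (truncnS_gt _) _.
  by rewrite ler_nat ltnS /n (leq_trans (leq_maxr _ _) (leqnSn _)).
apply: ltW; apply: lt_le_trans (truncnS_gt _) _.
by rewrite ler_nat ltnS /n (leq_trans (leq_maxl _ _) (leqnSn _)).
Qed.

Let cFs s : 0 < s -> {for s, continuous F}.
Proof.
move=> s0; apply: differentiable_continuous; apply/derivable1_diffP.
by have [] := dF s0.
Qed.

Let mf : measurable_fun H f.
Proof.
apply: open_continuous_measurable_fun; first exact: interval_open.
by move=> x /[!inE] xH; apply: cf.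
Qed.

Let integral_E n : (\int[leb]_(s in E n) (f s)%:E =
  (F n.+2%:R)%:E - (F n.+2%:R^-1)%:E)%E.
Proof.
have [n0 n1] := n2 n.
apply: continuous_FTC2 => //.
- apply: continuous_in_subspaceT => s /[!inE] /EH sH; apply: cf.
  by rewrite inE.
- split.
  + move=> s; rewrite in_itv/= => /andP[s1 _].
    by have [] := dF (lt_trans n0 s1).
  + by apply: cvg_at_right_filter; exact: cFs.
  + by apply: cvg_at_left_filter; apply: cFs; exact: lt_trans n0 n1.
- move=> s; rewrite in_itv/= => /andP[s1 _]; rewrite derive1E.
  by have [] := dF (lt_trans n0 s1).
Qed.

(** The integral is the increasing limit of integrals over segments, which the
    bound on the primitive keeps below [2 * C]. *)
Lemma improper_integrable (C : R) : (forall s, 0 < s -> 0 <= f s) ->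
  (forall s, 0 < s -> `|F s| <= C) -> leb.-integrable H (EFin \o f).
Proof.
move=> f0 FC.
have fH s : H s -> 0 <= f s by rewrite /= in_itv/= andbT; exact: f0.
have cvgI : (\int[leb]_(s in E n) (f s)%:E @[n --> \oo] -->
    \int[leb]_(s in H) (f s)%:E)%E.
  rewrite -EU; apply: ge0_nondecreasing_set_cvg_integral => //.
  - by move=> n; apply/measurable_EFinP; apply: measurable_funS mf.
  - by move=> n s /EH /fH; rewrite lee_fin.
apply/integrableP; split; first exact/measurable_EFinP.
apply: (@le_lt_trans _ _ (2 * C)%:E); last exact: ltry.
rewrite (_ : (\int[leb]_(s in H) _)%E = (\int[leb]_(s in H) (f s)%:E)%E); last first.
  by apply: eq_integral => s /[!inE] sH; rewrite /= ger0_norm// fH.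
rewrite -(cvg_lim _ cvgI)//; apply: lime_le; first by apply/cvg_ex; eexists; exact: cvgI.
apply: nearW => n.
rewrite integral_E -EFinB lee_fin; have [n0 n1] := n2 n.
have := FC _ n0; have := FC n.+2%:R (lt_trans n0 n1).
by rewrite !ler_norml; lra.
Qed.

(** By dominated convergence, the integral is the limit of the increments of the
    primitive over segments. *)
Lemma improper_FTC : leb.-integrable H (EFin \o f) ->
  (F n.+2%:R - F n.+2%:R^-1) @[n --> \oo] --> 0 ->
  \int[leb]_(s in H) f s = 0.
Proof.
move=> intf F0.
have cvgI : (\int[leb]_(s in H) (f s * \1_(E n) s)%:E @[n --> \oo] -->
    \int[leb]_(s in H) (f s)%:E)%E.
  have mH : measurable H by exact: measurable_itv.
  apply: (@dominated_cvg _ _ R leb H mH (fun n s => (f s * \1_(E n) s)%:E)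
    (EFin \o f) (abse \o (EFin \o f))) => //.
  - move=> n; apply/measurable_EFinP; apply: measurable_funM => //.
  - move=> s sH; have [N _ EN] : (\bigcup_n E n) s by rewrite EU.
    apply: cvg_near_cst; exists N => // n /= Nn.
    rewrite indicE mem_set ?mulr1//.
    by have := ndE Nn; rewrite subsetEset; apply.
  - exact: integrable_abse.
  - move=> n s sH; rewrite abse_EFin lee_fin normrM ler_piMr//.
    by rewrite indicE; case: (_ \in _); rewrite ?normr1 ?normr0.
rewrite /Rintegral; suff -> : (\int[leb]_(s in H) (f s)%:E = 0)%E by [].
apply: cvg_unique cvgI _ => //.
rewrite (_ : (fun n => _) = fun n => (F n.+2%:R - F n.+2%:R^-1)%:E).
  by apply: cvg_EFin => //; exact: nearW.
apply/funext => n; rewrite EFinB -integral_E.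
rewrite [LHS]integral_mkcond [RHS]integral_mkcond; apply: eq_integral => s _.
rewrite !patchE indicE; case: ifPn => sH.
  by case: ifP => _; rewrite ?mulr1 ?mulr0.
by case: ifPn => // /[!inE] /EH; rewrite -inE (negbTE sH).
Qed.

End improper_integrals.

Section power_derivatives.
Context {R : realType}.
Implicit Types x a : R.

Lemma powRB1 x a : 0 < x -> x `^ (a - 1) = x `^ a / x.
Proof.
move=> x0; rewrite powRD ?(gt_eqF x0) ?implybT//.
by rewrite powR_inv1// ltW.
Qed.

Lemma continuous_powR_pos x a : 0 < x -> {for x, continuous (@powR R ^~ a)}.
Proof.
move=> x0; apply: differentiable_continuous; apply/derivable1_diffP.
by have [] := is_derive1_powR a x0.
Qed.

Lemma is_derive_powR_comp (f : R -> R) (t df a : R) : 0 < f t ->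
  is_derive t 1 f df ->
  is_derive t 1 (fun t => f t `^ a) (a * (f t `^ a / f t) * df).
Proof.
move=> ft0 fd; have := is_derive1_comp (is_derive1_powR a ft0) fd.
by rewrite powRB1.
Qed.

End power_derivatives.

Section beta_integral.
Context {R : realType}.
Local Notation leb := (@lebesgue_measure R).
Local Notation H := (`]0, +oo[%classic : set (measurableTypeR R)).
Variables d b : R.
Hypotheses (d_gt0 : 0 < d) (d_lt_b : d < b).

Definition beta_integrand (s : R) : R := s `^ (d - 1) * (s + 1) `^ (- b).

Definition beta_constant : R := \int[leb]_(s in H) beta_integrand s.

Lemma beta_integrand_gt0 s : 0 < s -> 0 < beta_integrand s.
Proof. by move=> s0; rewrite mulr_gt0 ?powR_gt0//; lra. Qed.

Let db : 0 < b - d. Proof. by rewrite subr_gt0. Qed.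
(* The integrand is at most [f = F'], and [F] is bounded. For [s <= 1] the first
   term of [f] suffices, as [(s + 1) ^ (- d - 1) >= 1 / K1]; for [s >= 1] the
   second one does, as [s ^ (d - 1) <= (s + 1) ^ d * 2 / (s + 1)]. *)
Let K1 := 2 `^ (d + 1).
Let K2 := 2 / (b - d).
Let F (s : R) := K1 / d * (s `^ d * (s + 1) `^ (- d)) - K2 * (s + 1) `^ (- (b - d)).
Let f (s : R) := K1 * (s `^ (d - 1) * (s + 1) `^ (- d - 1)) +
  2 * (s + 1) `^ (- (b - d) - 1).

Let dF (s : R) : 0 < s -> is_derive s 1 F (f s).
Proof.
move=> s0; have s1 : 0 < s + 1 by lra.
have h : is_derive s 1 (fun s : R => s + 1) 1.
  by apply: is_derive_eq; rewrite addr0.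
have h1 := @is_derive_powR_comp _ (fun s => s + 1) s 1 (- d) s1 h.
have h2 := @is_derive_powR_comp _ (fun s => s + 1) s 1 (- (b - d)) s1 h.
have h3 := is_derive1_powR d s0.
apply: is_derive_eq; rewrite /f /GRing.scale/= !powRB1// /K2.
by field; rewrite !(gt_eqF s0, gt_eqF s1, gt_eqF d_gt0, gt_eqF db).
Qed.

Let cf : {in `]0, +oo[, continuous f}.
Proof.
move=> s; rewrite in_itv/= andbT => s0.
have c1 a : {for s, continuous (fun s : R => (s + 1) `^ a)}.
  apply: (@continuous_comp _ _ _ (fun s : R => s + 1) (@powR R ^~ a) s).
    by apply: cvgD; [exact: cvg_id|exact: cvg_cst].
  by apply: continuous_powR_pos; lra.
apply: cvgD; apply: cvgM; try exact: cvg_cst; try exact: c1.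
by apply: cvgM; [exact: continuous_powR_pos|exact: c1].
Qed.

Let f_ge0 s : 0 < s -> 0 <= f s.
Proof. by move=> s0; rewrite addr_ge0// !mulr_ge0// powR_ge0. Qed.

Let beta_le s : 0 < s -> beta_integrand s <= f s.
Proof.
have := d_lt_b; have := d_gt0 => d0 dltb s0; rewrite /beta_integrand /f.
have [s1|s1] := leP s 1.
  rewrite -[leLHS]addr0; apply: lerD; last by rewrite mulr_ge0// powR_ge0.
  rewrite mulrCA; apply: ler_wpM2l; first exact: powR_ge0.
  apply: (@le_trans _ _ 1).
    rewrite powRN invf_le1 ?powR_gt0//; last by lra.
    by rewrite -[leLHS](powRr0 (s + 1)) ler_powR//; lra.
  rewrite -opprD powRN -(@powRr1 _ 1)// ?powR1.
  rewrite ler_pdivlMr ?powR_gt0// ?mul1r; last lra.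
  by apply: ge0_ler_powR; rewrite ?nnegrE; lra.
rewrite -[leLHS]add0r; apply: lerD; first by rewrite !mulr_ge0// powR_ge0.
have -> : (s + 1) `^ (- (b - d) - 1) = (s + 1) `^ d * (s + 1) `^ (- b) / (s + 1).
  rewrite powRB1; last lra.
  rewrite -powRD; last by rewrite (gt_eqF (_ : 0 < s + 1)) ?implybT//; lra.
  by congr (_ `^ _ / _); lra.
rewrite powRB1//; set P := (s + 1) `^ (- b).
have -> : s `^ d / s * P = P * (s `^ d * s^-1) by ring.
have -> : 2 * ((s + 1) `^ d * P / (s + 1)) = P * ((s + 1) `^ d * (2 / (s + 1))) by ring.
apply: ler_wpM2l; first exact: powR_ge0.
apply: ler_pM; rewrite ?powR_ge0 ?invr_ge0 ?(ltW s0)//.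
  by apply: ge0_ler_powR; rewrite ?nnegrE; lra.
by rewrite -[2]invrK -invfM lef_pV2 ?posrE; lra.
Qed.

Let F_bounded s : 0 < s -> `|F s| <= K1 / d + K2.
Proof.
have := d_lt_b; have := d_gt0 => d0 dltb s0; have s1 : 0 < s + 1 by lra.
have le1 a : 0 <= a -> (s + 1) `^ (- a) <= 1.
  move=> a0; rewrite powRN invf_le1 ?powR_gt0//.
  by rewrite -[leLHS](powRr0 (s + 1)) ler_powR//; lra.
apply: le_trans (ler_normB _ _) _; apply: lerD.
  rewrite ger0_norm ?mulr_ge0 ?powR_ge0 ?invr_ge0 ?(ltW d_gt0)//.
  rewrite ler_piMr ?mulr_ge0 ?powR_ge0 ?invr_ge0 ?(ltW d_gt0)//.
  rewrite powRN ler_pdivrMr ?powR_gt0// mul1r.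
  by apply: ge0_ler_powR; rewrite ?nnegrE; lra.
have K20 : 0 <= K2 by rewrite /K2 divr_ge0//; lra.
rewrite ger0_norm; last by apply: mulr_ge0 => //; exact: powR_ge0.
by rewrite ler_piMr// le1//; lra.
Qed.

Lemma measurable_beta_integrand :
  measurable_fun setT (beta_integrand : measurableTypeR R -> R).
Proof.
by apply: measurable_funM; [exact: measurable_powR|exact: measurable_powR_translate].
Qed.

Lemma integrable_beta : leb.-integrable H (EFin \o beta_integrand).
Proof.
apply: le_integrable (improper_integrable dF cf f_ge0 F_bounded) => //.
- by apply/measurable_EFinP; apply: measurable_funTS; exact: measurable_beta_integrand.
- move=> s /=; rewrite in_itv/= andbT => s0.
  rewrite lee_fin !ger0_norm ?f_ge0//; first exact: beta_le.
  by rewrite ltW// beta_integrand_gt0.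
Qed.

Lemma beta_constant_gt0 : 0 < beta_constant.
Proof.
have B0 : 0 <= beta_constant.
  apply: Rintegral_ge0 => s /=; rewrite in_itv/= andbT => s0.
  by rewrite ltW// beta_integrand_gt0.
rewrite lt_neqAle B0 andbT eq_sym; apply/eqP => B_eq0.
have mB : measurable_fun H (EFin \o beta_integrand).
  by apply/measurable_EFinP; apply: measurable_funTS; exact: measurable_beta_integrand.
have [+ _] := ae_eq_integral_abs leb (measurable_itv `]0, +oo[) mB.
have -> : (\int[leb]_(x in H) `|(EFin \o beta_integrand) x| = 0)%E.
  have mH : measurable H by exact: measurable_itv.
  have <- : (\int[leb]_(x in H) (EFin \o beta_integrand) x = 0)%E.
    by rewrite -[LHS]fineK ?(integrable_fin_num mH integrable_beta)//; congr EFin.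
  apply: eq_integral => s /[!inE]/=; rewrite in_itv/= andbT => s0.
  by rewrite ger0_norm// ltW// beta_integrand_gt0.
move=> /(_ erefl) [N [mN N0 HN]].
have : (leb H <= leb N)%E.
  apply: le_measure; rewrite ?inE//.
  move=> s sH; apply: HN => /= /(_ sH) [] bs0.
  move: sH; rewrite /= in_itv/= andbT => /beta_integrand_gt0.
  by rewrite bs0 ltxx.
by rewrite N0 lebesgue_measure_itv/= ltry leye_eq.
Qed.

End beta_integral.

(** * Powers on the slit plane as fractional integrals of powers *)

Section half_angle.
Context {R : realType}.

Definition half_angle_arg (x y : R) : R :=
  2 * atan (y / (Num.sqrt (x ^+ 2 + y ^+ 2) + x)).

(** The real part of [exp (i * phi) * (x + i * y) ^ - g]; the values [0] and
    [- pi / 2] of [phi] give the real and imaginary parts of the power. *)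
Definition phase_power (g phi x y : R) : R :=
  (x ^+ 2 + y ^+ 2) `^ (- (g / 2)) * cos (phi - g * half_angle_arg x y).

(** This is the derivative of the argument of [x + i * y]: with [r] its modulus,
    [1 + (y / (r + x)) ^ 2 = 2 * r / (r + x)]. *)
Lemma is_derive_half_angle (x y : R -> R) (t dx dy : R) :
  is_derive t 1 x dx -> is_derive t 1 y dy ->
  0 < Num.sqrt (x t ^+ 2 + y t ^+ 2) + x t ->
  is_derive t 1 (fun t => half_angle_arg (x t) (y t))
    ((x t * dy - y t * dx) / (x t ^+ 2 + y t ^+ 2)).
Proof.
move=> hx hy; set r := Num.sqrt _ => rx.
have q0 : 0 < x t ^+ 2 + y t ^+ 2.
  rewrite lt_neqAle addr_ge0 ?sqr_ge0// andbT; apply/eqP => q0.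
  move: rx; rewrite /r -q0 sqrtr0 add0r => x0.
  by have := sqr_ge0 (y t); nra.
have r0 : 0 < r by rewrite sqrtr_gt0.
have r2 : r ^+ 2 = x t ^+ 2 + y t ^+ 2 by rewrite sqr_sqrtr// ltW.
pose q (t : R) := x t ^+ 2 + y t ^+ 2.
have hq : is_derive t 1 q (2 * x t * dx + 2 * y t * dy).
  apply: is_derive_eq; rewrite /GRing.scale/=; ring.
have hr := @is_derive1_comp _ (@Num.sqrt R) q t _ _ (is_derive1_sqrt q0) hq.
pose v (t : R) := Num.sqrt (q t) + x t.
have hv : is_derive t 1 v ((2 * r)^-1 * (2 * x t * dx + 2 * y t * dy) + dx).
  exact: is_deriveD.
have vt : v t = r + x t by [].
have v0 : v t != 0 by rewrite vt gt_eqF.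
have hV := is_deriveV v0 hv.
have hu := is_deriveM hy hV.
have ha := @is_derive1_comp _ atan (fun t => y t * (v t)^-1) t _ _ (is_derive1_atan _) hu.
refine (is_derive_eq (is_deriveZ 2 ha) _); rewrite /GRing.scale/= -/(v t) vt.
have rn0 : r != 0 by rewrite gt_eqF.
have rxn0 : r + x t != 0 by rewrite gt_eqF.
have e1 : 1 + (y t * (r + x t)^-1) ^+ 2 = 2 * r / (r + x t).
  have -> : 1 + (y t * (r + x t)^-1) ^+ 2 =
            ((r + x t) ^+ 2 + y t ^+ 2) / (r + x t) ^+ 2 by field.
  have -> : (r + x t) ^+ 2 + y t ^+ 2 = 2 * r * (r + x t).
    by have -> : y t ^+ 2 = r ^+ 2 - x t ^+ 2 by [rewrite r2; ring]; ring.
  by field.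
rewrite e1 -r2.
have -> : y t * (- (r + x t) ^- 2 * ((2 * r)^-1 * (2 * x t * dx + 2 * y t * dy) + dx)) +
   (r + x t)^-1 * dy = (x t * dy - y t * dx) / (r * (r + x t)).
  have ey : y t * y t = (r - x t) * (r + x t).
    by have -> : y t * y t = r ^+ 2 - x t ^+ 2 by [rewrite r2; ring]; ring.
  have -> : y t * (- (r + x t) ^- 2 * ((2 * r)^-1 * (2 * x t * dx + 2 * y t * dy) + dx)) +
   (r + x t)^-1 * dy = ((r * (r + x t) - y t * y t) * dy - y t * (x t + r) * dx)
     / (r * (r + x t) ^+ 2) by field; rewrite rn0 rxn0.
  by rewrite ey; field; rewrite rn0 rxn0.
by field; rewrite rn0 rxn0.
Qed.

End half_angle.

Lemma is_derive_continuous {R : realType} (f : R -> R) (t df : R) :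
  is_derive t 1 f df -> {for t, continuous f}.
Proof.
by move=> [fd _]; apply: differentiable_continuous; apply/derivable1_diffP.
Qed.

Section unit_circle.
Context {R : realType}.
Local Notation leb := (@lebesgue_measure R).
Local Notation H := (`]0, +oo[%classic : set (measurableTypeR R)).
Variables d b phi : R.
Hypotheses (d_gt0 : 0 < d) (d_lt_b : d < b).

(* [rho] and [arg] are the squared modulus and the argument of
   [s + exp (i * th)]; [p] is the real part of
   [exp (i * phi) * s ^ (d - 1) * exp (i * (b - d) * th) *
    (s + exp (i * th)) ^ - b], and [q] the imaginary part of [s] times the same
   product. The common value of [dp / dth] and [dq / ds] is [f]. *)
Let x (th s : R) : R := cos th + s.
Let rho (th s : R) : R := x th s ^+ 2 + sin th ^+ 2.
Let arg (th s : R) : R := half_angle_arg (x th s) (sin th).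
Let N (th s : R) : R := phi + (b - d) * th - b * arg th s.
Let W (th s : R) : R := rho th s `^ (- (b / 2)).
Let p (th s : R) : R := s `^ (d - 1) * (W th s * cos (N th s)).
Let q (th s : R) : R := s `^ d * (W th s * sin (N th s)).
Let f (th s : R) : R := s `^ (d - 1) * (W th s *
  (b * s * sin th / rho th s * cos (N th s) -
   ((b - d) - b * (1 + s * cos th) / rho th s) * sin (N th s))).

Let sin2 (th : R) : sin th ^+ 2 = 1 - cos th ^+ 2.
Proof. by rewrite -(cos2Dsin2 th); ring. Qed.

(* For [c0 = cos th], [(1 + c0) / 2] is the squared cosine of [th / 2]; a
   smaller [c0] makes the bound uniform in [th]. *)
Let rho_ge (c0 th s : R) : c0 <= cos th -> 0 < s ->
  (1 + c0) / 2 * (s + 1) ^+ 2 <= rho th s.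
Proof.
move=> ct s0; apply: (@le_trans _ _ ((1 + cos th) / 2 * (s + 1) ^+ 2)).
  by apply: ler_wpM2r; [exact: sqr_ge0|lra].
rewrite /rho /x sin2 -subr_ge0.
have -> : (cos th + s) ^+ 2 + (1 - cos th ^+ 2) - (1 + cos th) / 2 * (s + 1) ^+ 2 =
  (1 - cos th) / 2 * (1 - s) ^+ 2 by field.
apply: mulr_ge0; last exact: sqr_ge0.
by have := cos_le1 th; lra.
Qed.

Let rho_gt0 (th s : R) : -1 < cos th -> 0 < s -> 0 < rho th s.
Proof.
move=> c1 s0; apply: lt_le_trans (rho_ge (lexx _) s0).
apply: mulr_gt0; first by lra.
by rewrite exprn_gt0//; lra.
Qed.

Let slit (th s : R) : -1 < cos th -> 0 < s -> 0 < Num.sqrt (rho th s) + x th s.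
Proof.
move=> c1 s0; have [x0|x0] := ltP 0 (x th s).
  by have := sqrtr_ge0 (rho th s); lra.
suff : Num.sqrt (x th s ^+ 2) < Num.sqrt (rho th s) by rewrite sqrtr_sqr ler0_norm//; lra.
rewrite ltr_sqrt; last exact: rho_gt0.
rewrite /rho sin2; move: x0; rewrite /x => x0.
have : (1 - cos th) * (1 + cos th) > 0 by apply: mulr_gt0; lra.
by rewrite (_ : (1 - cos th) * _ = 1 - cos th ^+ 2); [lra|ring].
Qed.

Let hx_th (th s : R) : is_derive th 1 (x ^~ s) (- sin th).
Proof.
refine (is_derive_eq (is_deriveD (is_derive_cos th) (is_derive_cst s th 1)) _).
exact: addr0.
Qed.

Let hx_s (th s : R) : is_derive s 1 (x th) 1.
Proof.
refine (is_derive_eq (is_deriveD (is_derive_cst (cos th) s 1) (is_derive_id s 1)) _).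
exact: add0r.
Qed.

Let hrho_th (th s : R) : is_derive th 1 (rho ^~ s) (- 2 * s * sin th).
Proof.
have h1 := hx_th th s.
rewrite /rho; apply: is_derive_eq; rewrite /GRing.scale/= /x; ring.
Qed.

Let hrho_s (th s : R) : is_derive s 1 (rho th) (2 * x th s).
Proof.
have h1 := hx_s th s.
rewrite /rho; apply: is_derive_eq; rewrite /GRing.scale/=; ring.
Qed.

Let harg_th (th s : R) : -1 < cos th -> 0 < s ->
  is_derive th 1 (arg ^~ s) ((1 + s * cos th) / rho th s).
Proof.
move=> c1 s0; apply: (is_derive_eq (is_derive_half_angle (hx_th th s) (is_derive_sin th) _)).
  exact: slit.
congr (_ / _); rewrite /x mulrN opprK -expr2 sin2; ring.
Qed.

Let harg_s (th s : R) : -1 < cos th -> 0 < s ->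
  is_derive s 1 (arg th) (- sin th / rho th s).
Proof.
move=> c1 s0.
apply: (is_derive_eq (is_derive_half_angle (hx_s th s) (is_derive_cst (sin th) s 1) _)).
  exact: slit.
by congr (_ / _); rewrite mulr0 sub0r mulr1.
Qed.

Let hN_th (th s : R) : -1 < cos th -> 0 < s ->
  is_derive th 1 (N ^~ s) ((b - d) - b * (1 + s * cos th) / rho th s).
Proof.
move=> c1 s0; have h := harg_th c1 s0.
rewrite /N; apply: is_derive_eq; rewrite /GRing.scale/=; ring.
Qed.

Let hN_s (th s : R) : -1 < cos th -> 0 < s ->
  is_derive s 1 (N th) (b * sin th / rho th s).
Proof.
move=> c1 s0; have h := harg_s c1 s0.
rewrite /N; apply: is_derive_eq; rewrite /GRing.scale/=; ring.
Qed.

Let dp (th s : R) : -1 < cos th -> 0 < s -> is_derive th 1 (p ^~ s) (f th s).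
Proof.
move=> c1 s0; have r0 := rho_gt0 c1 s0.
have h1 := @is_derive_powR_comp _ (rho ^~ s) th _ (- (b / 2)) r0 (hrho_th th s).
have h2 := @is_derive1_comp _ cos (N ^~ s) th _ _ (is_derive_cos _) (hN_th c1 s0).
refine (is_derive_eq (is_deriveZ (s `^ (d - 1)) (is_deriveM h1 h2)) _).
rewrite /f /GRing.scale/= -/(W th s).
by field; rewrite gt_eqF.
Qed.

Let dq (th s : R) : -1 < cos th -> 0 < s -> is_derive s 1 (q th) (f th s).
Proof.
move=> c1 s0; have r0 := rho_gt0 c1 s0.
have h1 := @is_derive_powR_comp _ (rho th) s _ (- (b / 2)) r0 (hrho_s th s).
have h2 := @is_derive1_comp _ sin (N th) s _ _ (is_derive_sin _) (hN_s c1 s0).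
have h3 := is_derive1_powR d s0.
refine (is_derive_eq (is_deriveM h3 (is_deriveM h1 h2)) _).
rewrite /f /GRing.scale/= -/(W th s) powRB1//.
have e : rho th s = 1 + 2 * s * cos th + s ^+ 2 by rewrite /rho /x sin2; ring.
have r1 : 1 + 2 * s * cos th + s ^+ 2 != 0 by rewrite -e gt_eqF.
rewrite e /x -[X in X * (d * _)]/(W th s * sin (N th s)).
by field; rewrite (gt_eqF s0) r1.
Qed.

Let cp (th : R) : -1 < cos th -> {in `]0, +oo[, continuous (p th)}.
Proof.
move=> c1 s; rewrite in_itv/= andbT => s0; have r0 := rho_gt0 c1 s0.
have h1 := @is_derive_powR_comp _ (rho th) s _ (- (b / 2)) r0 (hrho_s th s).
have h2 := @is_derive1_comp _ cos (N th) s _ _ (is_derive_cos _) (hN_s c1 s0).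
apply: cvgM; first exact: continuous_powR_pos.
exact: is_derive_continuous (is_deriveM h1 h2).
Qed.

Let cf (th : R) : -1 < cos th -> {in `]0, +oo[, continuous (f th)}.
Proof.
move=> c1 s; rewrite in_itv/= andbT => s0; have r0 := rho_gt0 c1 s0.
have h1 := @is_derive_powR_comp _ (rho th) s _ (- (b / 2)) r0 (hrho_s th s).
have h2 := @is_derive1_comp _ cos (N th) s _ _ (is_derive_cos _) (hN_s c1 s0).
have h3 := @is_derive1_comp _ sin (N th) s _ _ (is_derive_sin _) (hN_s c1 s0).
have cr : {for s, continuous (fun s => (rho th s)^-1)}.
  apply: cvgV; first by rewrite gt_eqF.
  exact: is_derive_continuous (hrho_s th s).
apply: cvgM; first exact: continuous_powR_pos.
apply: cvgM; first exact: is_derive_continuous h1.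
apply: cvgB; apply: cvgM; [|exact: is_derive_continuous h2| |
  exact: is_derive_continuous h3].
  by apply: cvgM => //; apply: cvgM; [apply: cvgM|]; [exact: cvg_cst|exact: cvg_id|exact: cvg_cst].
apply: cvgB; first exact: cvg_cst.
apply: cvgM => //; apply: cvgM; first exact: cvg_cst.
apply: cvgD; first exact: cvg_cst.
by apply: cvgM; [exact: cvg_id|exact: cvg_cst].
Qed.

Let W_le (c0 th s : R) : -1 < c0 -> c0 <= cos th -> 0 < s ->
  W th s <= ((1 + c0) / 2) `^ (- (b / 2)) * (s + 1) `^ (- b).
Proof.
move: (d_gt0) (d_lt_b) => d0 dltb c1 ct s0; have k0 : 0 < (1 + c0) / 2 by lra.
have -> : (s + 1) `^ (- b) = ((s + 1) ^+ 2) `^ (- (b / 2)).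
  rewrite -powR_mulrn; last by lra.
  by rewrite -powRrM; congr (_ `^ _); field.
rewrite -powRM ?sqr_ge0//; last exact: ltW.
apply: le_powRN; last exact: rho_ge.
  by lra.
by apply: mulr_gt0 => //; rewrite exprn_gt0//; lra.
Qed.

Let p_le (c0 th s : R) : -1 < c0 -> c0 <= cos th -> 0 < s ->
  `|p th s| <= ((1 + c0) / 2) `^ (- (b / 2)) * beta_integrand d b s.
Proof.
move=> c1 ct s0; rewrite /p /beta_integrand !normrM.
rewrite [leRHS]mulrCA ger0_norm ?powR_ge0//; apply: ler_wpM2l; first exact: powR_ge0.
rewrite (@ger0_norm _ (W th s)); last exact: powR_ge0.
apply: le_trans (W_le c1 ct s0); rewrite ler_piMr ?powR_ge0//.
by rewrite ler_norml cos_le1 cos_geN1.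
Qed.

Let q_le (c0 th s : R) : -1 < c0 -> c0 <= cos th -> 0 < s ->
  `|q th s| <= ((1 + c0) / 2) `^ (- (b / 2)) * (s `^ d * (s + 1) `^ (- b)).
Proof.
move=> c1 ct s0; rewrite /q !normrM.
rewrite [leRHS]mulrCA ger0_norm ?powR_ge0//; apply: ler_wpM2l; first exact: powR_ge0.
rewrite (@ger0_norm _ (W th s)); last exact: powR_ge0.
apply: le_trans (W_le c1 ct s0); rewrite ler_piMr ?powR_ge0//.
by rewrite ler_norml sin_le1 sin_geN1.
Qed.

Let f_const (c0 : R) := ((1 + c0) / 2) `^ (- (b / 2)) *
  (b / ((1 + c0) / 2) + (b + b / ((1 + c0) / 2))).

Let f_le (c0 th s : R) : -1 < c0 -> c0 <= cos th -> 0 < s ->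
  `|f th s| <= f_const c0 * beta_integrand d b s.
Proof.
move: (d_gt0) (d_lt_b) => d0 dltb c1 ct s0; have k0 : 0 < (1 + c0) / 2 by lra.
have r0 : 0 < rho th s by apply: rho_gt0 => //; lra.
have rs := rho_ge ct s0.
have W0 : 0 <= W th s by exact: powR_ge0.
set k := (1 + c0) / 2 in k0 rs *.
have rk : (s + 1) / rho th s <= k^-1.
  rewrite ler_pdivrMr// mulrC ler_pdivlMr//.
  apply: le_trans rs; rewrite [leLHS]mulrC; apply: ler_wpM2l; first exact: ltW.
  by have := s0; nra.
rewrite /f /beta_integrand /f_const -/k !normrM.
rewrite (@ger0_norm _ (s `^ _)) ?powR_ge0//.
rewrite [leRHS]mulrCA; apply: ler_wpM2l; first exact: powR_ge0.
rewrite ger0_norm// [leRHS]mulrAC; apply: ler_pM => //.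
  exact: W_le.
apply: le_trans (ler_normB _ _) _; apply: lerD.
  rewrite normrM -[leRHS]mulr1; apply: ler_pM => //; last first.
    by rewrite ler_norml cos_le1 cos_geN1.
  rewrite !normrM (ger0_norm (ltW s0)) ger0_norm; last by lra.
  rewrite (@ger0_norm _ (rho th s)^-1); last by rewrite invr_ge0 ltW.
  rewrite -!mulrA; apply: ler_wpM2l; first by lra.
  apply: le_trans rk; rewrite mulrA; apply: ler_wpM2r; first by rewrite invr_ge0 ltW.
  apply: (@le_trans _ _ (s * 1)); last by lra.
  by apply: ler_wpM2l; [exact: ltW|rewrite ler_norml sin_le1 sin_geN1].
rewrite normrM -[leRHS]mulr1; apply: ler_pM => //; last first.
  by rewrite ler_norml sin_le1 sin_geN1.
apply: le_trans (ler_normB _ _) _; apply: lerD.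
  by rewrite ger0_norm; lra.
rewrite !normrM ger0_norm; last by lra.
rewrite (@ger0_norm _ (rho th s)^-1); last by rewrite invr_ge0 ltW.
rewrite -!mulrA; apply: ler_wpM2l; first by lra.
apply: le_trans rk; apply: ler_wpM2r; first by rewrite invr_ge0 ltW.
rewrite ler_norml; have := cos_le1 th; have := cos_geN1 th; nra.
Qed.

Let integrable_beta_scaled c : leb.-integrable H (EFin \o fun s => c * beta_integrand d b s).
Proof.
rewrite (_ : _ \o _ = fun s => c%:E * (beta_integrand d b s)%:E)%E.
  by apply: integrableZl; [exact: measurable_itv|exact: integrable_beta].
by apply/funext => s /=; rewrite EFinM.
Qed.

Let f_const_ge0 c0 : -1 < c0 -> 0 <= f_const c0.
Proof.
move: (d_gt0) (d_lt_b) => d0 dltb c1; have k0 : 0 < (1 + c0) / 2 by lra.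
by rewrite mulr_ge0 ?powR_ge0// !addr_ge0 ?divr_ge0 ?(ltW k0)//; lra.
Qed.

Let integrable_dominated (g : R -> R) c : {in `]0, +oo[, continuous g} -> 0 <= c ->
  (forall s, 0 < s -> `|g s| <= c * beta_integrand d b s) ->
  leb.-integrable H (EFin \o g).
Proof.
move=> cg c0 gc; apply: le_integrable (integrable_beta_scaled c) => //.
  apply/measurable_EFinP; apply: open_continuous_measurable_fun.
    exact: interval_open.
  by move=> s /[!inE] sH; apply: cg.
move=> s /=; rewrite in_itv/= andbT => s0; rewrite lee_fin.
rewrite [leRHS]ger0_norm ?gc//.
by rewrite mulr_ge0// ltW// beta_integrand_gt0.
Qed.

Let cvg_powR_invn (c : R) : 0 < c -> (n.+2%:R^-1 `^ c : R) @[n --> \oo] --> 0.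
Proof.
move=> c0; have /cvg_at_rightP := powR_cvg0 c0; apply; split.
  by move=> n; rewrite invr_gt0.
apply: (@squeeze_cvgr _ _ _ _ (cst 0) (@harmonic R)).
- apply: nearW => n; rewrite invr_ge0 ler0n/= /harmonic.
  by rewrite lef_pV2 ?posrE// ler_nat.
- exact: cvg_cst.
- exact: cvg_harmonic.
Qed.

Let q_vanishes (th : R) : -1 < cos th ->
  (q th n.+2%:R - q th n.+2%:R^-1) @[n --> \oo] --> 0.
Proof.
move: (d_gt0) (d_lt_b) => d0 dltb c1.
set C := ((1 + cos th) / 2) `^ (- (b / 2)).
have C0 : 0 <= C by exact: powR_ge0.
have small (u : nat -> R) c : 0 < c -> (forall n, `|u n| <= C * n.+2%:R^-1 `^ c) ->
    u n @[n --> \oo] --> 0.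
  move=> c0 uC; apply: norm_cvg0.
  apply: (@squeeze_cvgr _ _ _ _ (cst 0) (fun n => C * n.+2%:R^-1 `^ c)).
  - by apply: nearW => n; rewrite normr_ge0 uC.
  - exact: cvg_cst.
  - rewrite -(mulr0 C); apply: cvgM; first exact: cvg_cst.
    exact: cvg_powR_invn.
rewrite -(subr0 0); apply: cvgB.
- apply: (small _ (b - d)); first by rewrite subr_gt0.
  move=> n; have n0 : 0 < n.+2%:R :> R by [].
  apply: le_trans (q_le c1 (lexx _) n0) _; apply: ler_wpM2l => //.
  rewrite -powR_inv1 ?(ltW n0)// -powRrM.
  have -> : n.+2%:R `^ (-1 * (b - d)) = n.+2%:R `^ d * n.+2%:R `^ (- b) :> R.
    rewrite -powRD; last by rewrite (gt_eqF n0) implybT.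
    by congr (_ `^ _); ring.
  apply: ler_wpM2l; first exact: powR_ge0.
  by apply: le_powRN => //; lra.
- apply: (small _ d) => // n; have n0 : 0 < n.+2%:R^-1 :> R by rewrite invr_gt0.
  apply: le_trans (q_le c1 (lexx _) n0) _; apply: ler_wpM2l => //.
  rewrite ler_piMr ?powR_ge0//.
  apply: le_trans (_ : 1 `^ (- b) <= 1); last by rewrite powR1.
  by apply: le_powRN => //; [lra|rewrite lerDr ltW].
Qed.

Let integral_f (th : R) : -1 < cos th -> \int[leb]_(s in H) f th s = 0.
Proof.
move=> c1; apply: (@improper_FTC _ (q th)).
- by move=> s s0; exact: dq.
- exact: cf.
- apply: (@integrable_dominated _ (f_const (cos th))); first exact: cf.
    exact: f_const_ge0.
  by move=> s s0; exact: f_le.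
- exact: q_vanishes.
Qed.

Let G (th : R) : R := \int[leb]_(s in H) p th s.

Let dG (th1 th : R) : 0 < th1 < pi -> - th1 < th < th1 -> is_derive th 1 G 0.
Proof.
move=> /andP[t0 t1] tI.
have c1 : -1 < cos th1 by rewrite -cospi ltr_cos// in_itv/= ?lexx ?pi_ge0//; lra.
have c2 (t : R) : - th1 < t < th1 -> cos th1 <= cos t.
  move=> /andP[h1 h2]; have nt : `|t| < th1 by rewrite ltr_norml h1 h2.
  have -> : cos t = cos `|t| by case: (ger0P t) => _ //; rewrite cosN.
  by rewrite ltW// ltr_cos// in_itv/= ?normr_ge0; lra.
have c3 (t : R) : - th1 < t < th1 -> -1 < cos t.
  by move=> /c2; exact: lt_le_trans.
have mH : measurable H by exact: measurable_itv.
have aI : `](- th1), th1[%classic th by rewrite /= in_itv/=.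
have I1 (t : R) : `](- th1), th1[%classic t -> cos th1 <= cos t.
  by rewrite /= in_itv/=; exact: c2.
have p1 (t : R) : cos th1 <= cos t -> forall s, 0 < s -> partial1of2 p t s = f t s.
  move=> ct s s0; rewrite /partial1of2 derive1E.
  by have [_ ->] := dp (lt_le_trans c1 ct) s0.
have intp (t : R) : `](- th1), th1[%classic t -> leb.-integrable H (EFin \o p t).
  move=> /I1 ct.
  apply: (@integrable_dominated _ (((1 + cos th1) / 2) `^ (- (b / 2)))).
  + by apply: cp; exact: lt_le_trans ct.
  + exact: powR_ge0.
  + by move=> s s0; exact: p_le.
have derp (t : R) (s : measurableTypeR R) : `](- th1), th1[%classic t -> H s ->
    derivable (p ^~ s) t 1.
  move=> /I1 ct; rewrite /= in_itv/= andbT => s0.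
  by have [] := dp (lt_le_trans c1 ct) s0.
pose bound (s : R) := `|f_const (cos th1) * beta_integrand d b s|.
have bound0 s : 0 <= bound s by exact: normr_ge0.
have intb : leb.-integrable H (EFin \o bound).
  exact: integrable_norm (integrable_beta_scaled _).
have pb (t : R) (s : measurableTypeR R) : `](- th1), th1[%classic t -> H s ->
    `|partial1of2 p t s| <= bound s.
  move=> /I1 ct; rewrite /= in_itv/= andbT => s0.
  rewrite p1// /bound; apply: le_trans (ler_norm _); exact: f_le.
split.
- exact: (@derivable_under_integral _ _ _ leb p H mH th _ _ aI intp derp bound bound0 intb pb).
- rewrite -derive1E.
  rewrite (@differentiation_under_integral _ _ _ leb p H mH th _ _ aI intp derp bound bound0 intb pb).
  transitivity (\int[leb]_(s in H) f th s); last exact: integral_f (c3 _ tI).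
  apply: eq_Rintegral => s /[!inE].
  by rewrite /= in_itv/= andbT => s0; rewrite p1//; exact: I1.
Qed.

Let G_cst (th : R) : - pi < th < pi -> G th = G 0.
Proof.
move=> tI; pose th1 := (`|th| + pi) / 2.
have nt : `|th| < pi by rewrite ltr_norml.
have t1 : 0 < th1 < pi by have := normr_ge0 th; rewrite /th1; lra.
have tI1 : - th1 < th < th1.
  by rewrite -ltr_norml /th1; lra.
have I (a c : R) : - th1 < a -> a <= c -> c < th1 -> G c = G a.
  move=> ha ac hc.
  have dGI (t : R) : a <= t <= c -> is_derive t 1 G 0.
    by move=> tac; apply: (dG t1); lra.
  have [||t _] := @MVT_segment _ G (cst 0) a c ac.
  - by move=> t; rewrite in_itv/= => tac; apply: dGI; lra.
  - apply: derivable_within_continuous => t; rewrite in_itv/= => tac.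
    by have [] := dGI _ tac.
  - by rewrite mul0r => /eqP; rewrite subr_eq0 => /eqP.
have [th0|/ltW th0] := leP 0 th; first by apply: I; lra.
by apply/esym/I; lra.
Qed.

(** The [th]-derivative of the integrand is the [s]-derivative of a function that
    vanishes at [0] and at infinity, because [0 < d < b]; so the integral is the
    one for [th = 0]. *)
Lemma integral_unit_circle (th : R) : - pi < th < pi ->
  \int[leb]_(s in H) (s `^ (d - 1) *
    phase_power b (phi + (b - d) * th) (cos th + s) (sin th)) =
  cos phi * beta_constant d b.
Proof.
move=> /G_cst; rewrite -/(G th) => ->; rewrite /G; rewrite /beta_constant -RintegralZl//; last first.
  exact: integrable_beta.
apply: eq_Rintegral => s /[!inE]/=; rewrite in_itv/= andbT => s0.
have W0 : W 0 s = (s + 1) `^ (- b).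
  rewrite /W /rho /x sin0 cos0 expr0n addr0 addrC -powR_mulrn; last by lra.
  by rewrite -powRrM; congr (_ `^ _); field.
have N0 : N 0 s = phi by rewrite /N /arg /half_angle_arg sin0 mul0r atan0; ring.
by rewrite /p W0 N0 /beta_integrand; ring.
Qed.

End unit_circle.

Section slit_plane.
Context {R : realType}.
Local Notation leb := (@lebesgue_measure R).
Local Notation H := (`]0, +oo[%classic : set (measurableTypeR R)).
Implicit Types (w : R[i]) (g phi s x y r : R).

Lemma cargE w : carg w = half_angle_arg (complex.Re w) (complex.Im w).
Proof. by []. Qed.

Lemma slit_plane_gt0 w : slit_plane w -> 0 < cmodulus w /\ 0 < cmodulus w + complex.Re w.
Proof.
case: w => a b; rewrite /slit_plane/= => nab.
have r0 : 0 <= cmodulus (a +i* b)%C by exact: sqrtr_ge0.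
have r2 : cmodulus (a +i* b)%C ^+ 2 = a ^+ 2 + b ^+ 2.
  by rewrite /cmodulus/= sqr_sqrtr// addr_ge0// sqr_ge0.
have d0 : 0 < cmodulus (a +i* b)%C + a.
  rewrite ltNge; apply/negP => dle0; apply: nab.
  have b0 : b ^+ 2 = 0 by have := sqr_ge0 b; nra.
  by split; [apply/eqP; rewrite -sqrf_eq0 b0|lra].
split => //; rewrite lt_neqAle r0 andbT; apply/eqP => r00.
move: d0 r2; rewrite -r00 add0r => a0; rewrite expr0n/= => e.
by have := sqr_ge0 b; have := a0; nra.
Qed.

Lemma slit_planeD w s : slit_plane w -> 0 <= s -> slit_plane (s%:C%C + w).
Proof.
case: w => a b; rewrite /slit_plane/= => nab s0 [b0 a0]; apply: nab.
by rewrite add0r in b0; split => //; lra.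
Qed.

(** With [r] and [th] the modulus and the argument of [w], the square of
    [|w + s|] is at least [cos (th / 2) ^ 2 * (r + s) ^ 2]: this makes all the
    integrals below converge. *)
Lemma slit_plane_lower_bound w : slit_plane w ->
  exists2 c, 0 < c & forall s, 0 <= s ->
    c * (s + 1) ^+ 2 <= (complex.Re w + s) ^+ 2 + complex.Im w ^+ 2.
Proof.
move=> /slit_plane_gt0; set r := cmodulus w; move=> [r0 rx].
have r2 : r ^+ 2 = complex.Re w ^+ 2 + complex.Im w ^+ 2.
  by rewrite sqr_sqrtr// addr_ge0// sqr_ge0.
move: (complex.Re w) (complex.Im w) r2 rx => x y r2 rx.
pose m := Num.min 1 r.
have m0 : 0 < m by rewrite lt_min ltr01.
exists ((r + x) / (2 * r) * m ^+ 2).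
  by apply: mulr_gt0; [apply: divr_gt0; lra|exact: exprn_gt0].
move=> s s0; apply: (@le_trans _ _ ((r + x) / (2 * r) * (r + s) ^+ 2)).
  rewrite -[leLHS]mulrA -exprMn; apply: ler_wpM2l; first by apply: divr_ge0; lra.
  apply: lerXn2r; rewrite ?nnegrE; [|lra|].
    by apply: mulr_ge0; lra.
  have m1 : m <= 1 by rewrite ge_min lexx.
  have mr : m <= r by rewrite ge_min lexx orbT.
  by nra.
rewrite -subr_ge0.
have -> : (x + s) ^+ 2 + y ^+ 2 - (r + x) / (2 * r) * (r + s) ^+ 2 =
    (r - x) * (r - s) ^+ 2 / (2 * r).
  have -> : (x + s) ^+ 2 + y ^+ 2 = r ^+ 2 + 2 * x * s + s ^+ 2 by rewrite r2; ring.
  by field; rewrite gt_eqF.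
apply: divr_ge0; last by lra.
apply: mulr_ge0; last exact: sqr_ge0.
by have := sqr_ge0 y; nra.
Qed.

Lemma phase_power_bound w g phi : slit_plane w -> 0 <= g ->
  exists2 C, 0 <= C & forall s, 0 <= s ->
    `|phase_power g phi (complex.Re w + s) (complex.Im w)| <= C * (s + 1) `^ (- g).
Proof.
move=> /slit_plane_lower_bound[c c0 cP] g0.
exists (c `^ (- (g / 2))); first exact: powR_ge0.
move=> s s0; rewrite normrM ger0_norm ?powR_ge0//.
have s1 : 0 < s + 1 by lra.
have -> : (s + 1) `^ (- g) = ((s + 1) ^+ 2) `^ (- (g / 2)).
  rewrite -powR_mulrn; last exact: ltW.
  by rewrite -powRrM; congr (_ `^ _); field.
rewrite -powRM ?sqr_ge0//; last exact: ltW.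
rewrite -[leRHS]mulr1; apply: ler_pM; rewrite ?powR_ge0//; last first.
  by rewrite ler_norml cos_le1 cos_geN1.
apply: le_powRN; [lra| |exact: cP].
by apply: mulr_gt0 => //; exact: exprn_gt0.
Qed.

Lemma measurable_phase_power g phi x y :
  measurable_fun setT (fun s : measurableTypeR R => phase_power g phi (x + s) y).
Proof.
have mx : measurable_fun setT (fun s : measurableTypeR R => x + s).
  by apply: measurable_funD.
have mq : measurable_fun setT (fun s : measurableTypeR R => (x + s) ^+ 2 + y ^+ 2).
  by apply: measurable_funD => //; apply: measurable_funX.
apply: measurable_funM.
  apply: (@measurableT_comp _ _ _ _ _ _ (@powR R ^~ (- (g / 2)))) => //.
apply: (@measurableT_comp _ _ _ _ _ _ (@cos R)).
  by apply: continuous_measurable_fun; exact: continuous_cos.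
apply: measurable_funB => //; apply: measurable_funM => //; apply: measurable_funM => //.
apply: (@measurableT_comp _ _ _ _ _ _ (@atan R)).
  by apply: continuous_measurable_fun; exact: continuous_atan.
pose v s := Num.sqrt ((x + s) ^+ 2 + y ^+ 2) + (x + s).
have v0 s : 0 <= v s.
  rewrite /v -lerBlDr sub0r; apply: le_trans (ler_norm _) _.
  by rewrite normrN -sqrtr_sqr ler_wsqrtr// lerDl sqr_ge0.
rewrite (_ : (fun s => _) = fun s => y * v s `^ (-1)); last first.
  (* [v s] may vanish, but division by [v s] is multiplication by
     [v s `^ (-1)] for all [v s >= 0]. *)
  by apply/funext => s; rewrite powR_inv1.
apply: measurable_funM => //.
apply: (@measurableT_comp _ _ _ _ _ _ (@powR R ^~ (-1))).
  exact: measurable_powR.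
apply: measurable_funD => //.
apply: (@measurableT_comp _ _ _ _ _ _ (@Num.sqrt R)) => //.
by apply: continuous_measurable_fun; exact: sqrt_continuous.
Qed.

Lemma phase_powerZ r g phi x y : 0 < r ->
  phase_power g phi (r * x) (r * y) = r `^ (- g) * phase_power g phi x y.
Proof.
move=> r0; rewrite /phase_power.
have q0 : 0 <= x ^+ 2 + y ^+ 2 by rewrite addr_ge0// sqr_ge0.
have -> : (r * x) ^+ 2 + (r * y) ^+ 2 = r ^+ 2 * (x ^+ 2 + y ^+ 2) by ring.
have -> : half_angle_arg (r * x) (r * y) = half_angle_arg x y.
  rewrite /half_angle_arg.
  have -> : (r * x) ^+ 2 + (r * y) ^+ 2 = r ^+ 2 * (x ^+ 2 + y ^+ 2) by ring.
  rewrite sqrtrM ?sqr_ge0// sqrtr_sqr gtr0_norm// -mulrDr invfM.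
  by rewrite mulrACA divff ?gt_eqF// mul1r.
rewrite powRM ?sqr_ge0// -powR_mulrn ?(ltW r0)// -powRrM.
by rewrite mulrA; congr (_ `^ _ * _ * _); field.
Qed.

Section fixed_exponents.
Variables d b phi : R.
Hypotheses (d_gt0 : 0 < d) (d_lt_b : d < b).

Lemma integrable_slit_plane w : slit_plane w -> leb.-integrable H
  (EFin \o fun s => s `^ (d - 1) * phase_power b phi (complex.Re w + s) (complex.Im w)).
Proof.
move: (d_gt0) (d_lt_b) => d0 dltb ws.
have b0 : 0 <= b by lra.
have [C C0 CP] := phase_power_bound phi ws b0.
have mH : measurable H by exact: measurable_itv.
have iC : leb.-integrable H (EFin \o fun s => C * beta_integrand d b s).
  rewrite (_ : _ \o _ = fun s => C%:E * (beta_integrand d b s)%:E)%E.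
    by apply: integrableZl => //; exact: integrable_beta.
  by apply/funext => s /=; rewrite EFinM.
apply: le_integrable iC => //.
  apply/measurable_EFinP; apply: measurable_funTS; apply: measurable_funM.
    exact: measurable_powR.
  exact: measurable_phase_power.
move=> s /=; rewrite in_itv/= andbT => s0; rewrite lee_fin.
rewrite !normrM (ger0_norm C0) (ger0_norm (powR_ge0 _ _)) [leRHS]mulrCA.
apply: ler_wpM2l; first exact: powR_ge0.
by rewrite -normrM (ger0_norm (powR_ge0 (s + 1) _)); apply: CP; exact: ltW.
Qed.

(** The dilation by the modulus of [w] is an affine change of variables, and the
    argument of [w] is absorbed in the phase for the unit circle. *)
Lemma integral_slit_plane w : slit_plane w ->
  (\int[leb]_(s in H)
    (s `^ (d - 1) * phase_power b phi (complex.Re w + s) (complex.Im w))%:E =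
  (beta_constant d b * phase_power (b - d) phi (complex.Re w) (complex.Im w))%:E)%E.
Proof.
move=> ws; have [r0 _] := slit_plane_gt0 ws.
have wE := carg_polar ws; have wI := carg_bound w.
pose r := cmodulus w; pose th := carg w.
have xE : complex.Re w = r * cos th by rewrite {1}wE/= mul0r subr0.
have yE : complex.Im w = r * sin th by rewrite {1}wE/= mul0r addr0.
have mH : measurable H by exact: measurable_itv.
pose h s := s `^ (d - 1) * phase_power b phi (complex.Re w + s) (complex.Im w).
have mh : measurable_fun setT (h : measurableTypeR R -> R).
  by apply: measurable_funM; [exact: measurable_powR|exact: measurable_phase_power].
pose phi' := phi - (b - d) * th.
pose p s := s `^ (d - 1) * phase_power b (phi' + (b - d) * th) (cos th + s) (sin th).
have hr s : 0 < s -> h (r * s) = r `^ (d - 1 - b) * p s.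
  move=> s0; rewrite /h xE -mulrDr yE phase_powerZ// powRM ?(ltW r0) ?(ltW s0)//.
  have -> : r `^ (d - 1 - b) = r `^ (d - 1) * r `^ (- b).
    by rewrite -powRD// (gt_eqF r0) implybT.
  by rewrite /p /phi' subrK; ring.
have w1 : slit_plane (cos th +i* sin th)%C.
  move=> /= [s0 c0]; apply: ws; rewrite xE yE s0 mulr0; split=> //.
  by apply: mulr_ge0_le0 => //; exact: ltW.
have ip : leb.-integrable H (EFin \o p).
  by have := integrable_slit_plane w1; rewrite /= /p /phi' subrK.
have Ip : (\int[leb]_(s in H) (p s)%:E = (cos phi' * beta_constant d b)%:E)%E.
  rewrite -(integral_unit_circle phi' d_gt0 d_lt_b wI) /Rintegral fineK//.
  exact: integrable_fin_num.
have -> : phase_power (b - d) phi (complex.Re w) (complex.Im w) =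
    r `^ (- (b - d)) * cos phi'.
  rewrite /phase_power -cargE -/th; congr (_ * _).
  have -> : complex.Re w ^+ 2 + complex.Im w ^+ 2 = r ^+ 2.
    by rewrite sqr_sqrtr// addr_ge0// sqr_ge0.
  by rewrite -powR_mulrn ?(ltW r0)// -powRrM; congr (_ `^ _); field.
rewrite integral_mkcond (@integral_affine _ _ 0 r0); last first.
  apply/(measurable_restrictT _ _).1 => //; apply: measurable_funTS.
  exact/measurable_EFinP.
have -> : (\int[leb]_s ((fun s => (h s)%:E) \_ H) (r * s + 0)%R =
    (r `^ (d - 1 - b))%:E * \int[leb]_(s in H) (p s)%:E)%E.
  rewrite -integralZl// [RHS]integral_mkcond; apply: eq_integral => s _.
  rewrite addr0 !patchE.
  have -> : (r * s \in H) = (s \in H).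
    by apply/idP/idP; rewrite !inE/= !in_itv/= !andbT pmulr_rgt0.
  by case: ifPn => // /[!inE]/=; rewrite in_itv/= andbT => s0; rewrite hr// EFinM.
rewrite Ip -!EFinM; congr EFin.
have -> : r `^ (- (b - d)) = r `^ 1 * r `^ (d - 1 - b).
  by rewrite -powRD ?(gt_eqF r0) ?implybT//; congr (_ `^ _); ring.
by rewrite powRr1 ?(ltW r0)// -/r; ring.
Qed.

End fixed_exponents.

End slit_plane.

Section fractional_kernel.
Context {R : realType}.
Local Notation leb := (@lebesgue_measure R).
Local Notation H := (`]0, +oo[%classic : set (measurableTypeR R)).
Variables d b : R.
Hypotheses (d_gt0 : 0 < d) (d_lt_b : d < b).

Lemma integral_fractional_kernel (g : R -> R) (u : R) :
  measurable_fun setT (g : measurableTypeR R -> R) ->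
  (\int[leb]_y (fractional_kernel d (y - u) * g y)%:E =
   \int[leb]_(s in H) (s `^ (d - 1) * g (u + s))%:E)%E.
Proof.
move=> mg; rewrite (@integral_affine _ 1 u ltr01) ?mul1e; last first.
  apply/measurable_EFinP; apply: measurable_funM => //.
  apply: (measurableT_comp (measurable_fractional_kernel d)).
  by apply: measurable_funB.
rewrite [RHS]integral_mkcond; apply: eq_integral => s _.
rewrite patchE /fractional_kernel mul1r addrK (addrC s u).
have -> : (s \in H) = (0 < s) by apply/idP/idP; rewrite inE/= in_itv/= andbT.
by case: ifP => _ //; rewrite mul0r.
Qed.

(** Through Fubini, this identity raises the exponent of a transform from
    [b - d] to [b], and replaces the measure by its fractional integral of order
    [d]. *)
Lemma fractional_integral_phase_power (w : R[i]) (phi u : R) :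
  slit_plane w -> 0 <= u ->
  (\int[leb]_y (fractional_kernel d (y - u) *
     phase_power b phi (complex.Re w + y) (complex.Im w))%:E =
   (beta_constant d b *
     phase_power (b - d) phi (complex.Re w + u) (complex.Im w))%:E)%E.
Proof.
move=> ws u0; rewrite integral_fractional_kernel; last exact: measurable_phase_power.
have := integral_slit_plane phi d_gt0 d_lt_b (slit_planeD ws u0).
case: (w) => a c /=; rewrite add0r (addrC a u) => <-.
by apply: eq_integral => s _; rewrite addrCA addrA (addrC u).
Qed.

Lemma fractional_integral_powR (x u : R) : 0 < x -> 0 <= u ->
  (\int[leb]_y (fractional_kernel d (y - u) * (y + x) `^ (- b))%:E =
   (beta_constant d b * (u + x) `^ (- (b - d)))%:E)%E.
Proof.
move=> x0 u0.
have xs : slit_plane (x%:C)%C by move=> /= [_]; lra.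
have pE g y : 0 <= y -> (y + x) `^ (- g) = phase_power g 0 (x + y) 0.
  move=> y0; rewrite /phase_power /half_angle_arg mul0r atan0 !mulr0 subr0 cos0 mulr1.
  rewrite expr0n addr0 -powR_mulrn; last by lra.
  by rewrite -powRrM addrC; congr (_ `^ _); field.
rewrite pE// -(fractional_integral_phase_power 0 xs u0).
apply: eq_integral => y _; rewrite /fractional_kernel; case: ifPn => yu; last by rewrite !mul0r.
by rewrite pE//=; lra.
Qed.

End fractional_kernel.

(** * From the compactified half-line to the real line *)

Lemma sigma_finite_measureP d (T : measurableType d) (R : realType)
    (m : {measure set T -> \bar R}) : sigma_finite setT m ->
  exists m' : {sigma_finite_measure set T -> \bar R}, forall A, m' A = m A.
Proof.
move=> sf.
pose m' : {sigma_finite_measure set T -> \bar R} :=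
  HB.pack (Measure.sort m)
    (isSFinite.Build _ _ _ m (sfinite_measure_sigma_finite sf))
    (isSigmaFinite.Build _ _ _ m sf).
by exists m'.
Qed.

Section compactified_half_line.
Context {R : realType}.
Local Notation D := (`[0, +oo[%classic : set (measurableTypeR R)).
Local Notation E := [set t : \bar R | (0 <= t < +oo)%E].
Implicit Types (mu : {measure set (\bar R) -> \bar R}) (a : R).

Lemma measurable_ehalf_line : measurable E.
Proof.
rewrite (_ : E = [set` `[0%E, +oo%E[ ]); first exact: emeasurable_itv.
by apply/seteqP; split => t /=; rewrite in_itv.
Qed.

Lemma measurable_fine : measurable_fun setT (fine : \bar R -> measurableTypeR R).
Proof. exact: fine_measurable. Qed.

Lemma ehalf_line_fine (t : \bar R) : E t -> 0 <= fine t /\ t = (fine t)%:E.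
Proof.
by case: t => [r| |]/=; rewrite ?lee_fin ?ltxx ?andbF// => /andP[].
Qed.

(** The integrability of [(1 + t) ^ - a] gives a finite mass to each [[0, n]], and
    so the sigma-finiteness that Fubini requires. *)
Lemma half_line_measure mu a : 0 < a -> stieltjes_measure a mu ->
  exists sg : {sigma_finite_measure set (measurableTypeR R) -> \bar R},
  forall g : R -> \bar R, measurable_fun setT g -> (forall u, 0 <= g u)%E ->
    (\int[sg]_(u in D) g u = \int[mu]_(t in E) g (fine t))%E.
Proof.
move=> a0 [_ inta _].
have mE := measurable_ehalf_line.
have mD : measurable D by exact: measurable_itv.
have m1 : measurable_fun setT (fun t : \bar R => (\1_E t)%:E : \bar R).
  by apply/measurable_EFinP; exact: measurable_indic.
have [m [mA mint]] := density_measure mu m1 (fun t => ltac:(by rewrite lee_fin)).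
pose sg0 := image_measure m measurable_fine.
have sg0E (g : R -> \bar R) : measurable_fun setT g -> (forall u, 0 <= g u)%E ->
    (\int[sg0]_(u in D) g u = \int[mu]_(t in E) g (fine t))%E.
  move=> mg g0; have mfD : measurable (fine @^-1` D).
    by rewrite -[X in measurable X]setTI; apply: measurable_fine.
  have mgf : measurable_fun setT (g \o fine).
    exact: (measurableT_comp mg measurable_fine).
  rewrite (ge0_integral_pushforward measurable_fine)//; last exact: measurable_funTS.
  rewrite integral_mkcond mint; last 2 first.
  - by apply/(measurable_restrictT _ _).1 => //; exact: measurable_funTS.
  - by move=> t; rewrite patchE; case: ifP => //= _; exact: g0.
  rewrite [RHS]integral_mkcond; apply: eq_integral => t _; rewrite !patchE indicE.
  have [tE|tE] := boolP (t \in E); last by rewrite mule0.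
  rewrite mule1 mem_set//=; move: tE; rewrite inE => /ehalf_line_fine[t0 _].
  by rewrite in_itv/= t0.
have sf : sigma_finite setT sg0.
  exists (fun n => `]-oo, n%:R]%classic).
    apply/esym; rewrite -subTset => x _ /=; exists (Num.truncn `|x|).+1 => //=.
    by rewrite in_itv/= ltW// (le_lt_trans (ler_norm _))// truncnS_gt.
  move=> n; split; first exact: measurable_itv.
  have mF : measurable ((fine : \bar R -> R) @^-1` `]-oo, n%:R]%classic).
    have := measurable_fine measurableT (measurable_itv `]-oo, n%:R]).
    by rewrite setTI.
  rewrite /sg0/= /pushforward mA// integral_mkcond.
  apply: (@le_lt_trans _ _
    (\int[mu]_(t in E) ((1 + n%:R) `^ a * (1 + fine t) `^ (- a))%:E)%E).
    rewrite [leRHS]integral_mkcond; apply: ge0_le_integral => //.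
    + by move=> t _; rewrite patchE; case: ifP => //; rewrite lee_fin.
    + by apply/(measurable_restrictT _ _).1 => //; exact: measurable_funTS.
    + apply/(measurable_restrictT _ _).1 => //; apply/measurable_EFinP.
      apply: measurable_funTS; apply: measurable_funM => //.
      apply: (@measurableT_comp _ _ _ _ _ _ (@powR R ^~ (- a))).
        exact: measurable_powR.
      apply: measurable_funD => //; exact: measurable_fine.
    + move=> t _; rewrite !patchE indicE.
      have [tE|tE] := boolP (t \in E); last by case: ifP.
      move: tE; rewrite inE => /ehalf_line_fine[t0 _].
      case: ifPn => [|_]; last by rewrite lee_fin mulr_ge0// powR_ge0.
      rewrite inE/= in_itv/= => tn; rewrite lee_fin powRN ler_pdivlMr ?powR_gt0//; last lra.
      by rewrite mul1r; apply: ge0_ler_powR; rewrite ?nnegrE; lra.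
  under eq_integral do rewrite EFinM.
  rewrite ge0_integralZl//; last 2 first.
  - apply/measurable_EFinP; apply: measurable_funTS.
    apply: (@measurableT_comp _ _ _ _ _ _ (@powR R ^~ (- a))).
      exact: measurable_powR.
    by apply: measurable_funD => //; exact: measurable_fine.
  - by move=> t _; rewrite lee_fin powR_ge0.
  by rewrite lte_mul_pinfty// lee_fin powR_ge0.
have [sg sgE] := sigma_finite_measureP sf.
exists sg => g mg g0; rewrite -sg0E//; apply: eq_measure_integral => A mA' _.
exact: sgE.
Qed.

Lemma half_line_measure_signed mu (sg : {measure set (measurableTypeR R) -> \bar R}) :
    (forall g : R -> \bar R, measurable_fun setT g -> (forall u, 0 <= g u)%E ->
      (\int[sg]_(u in D) g u = \int[mu]_(t in E) g (fine t))%E) ->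
  forall g : R -> \bar R, measurable_fun setT g ->
    (\int[sg]_(u in D) g u = \int[mu]_(t in E) g (fine t))%E.
Proof.
move=> sgE g mg; rewrite integralE [RHS]integralE.
rewrite sgE//; last exact: measurable_funepos.
rewrite sgE//; last exact: measurable_funeneg.
by congr (_ - _)%E; apply: eq_integral => t _; rewrite ?funeposE ?funenegE.
Qed.

End compactified_half_line.

Section transform.
Context {R : realType}.
Local Notation E := [set t : \bar R | (0 <= t < +oo)%E].
Implicit Types (mu : {measure set (\bar R) -> \bar R}) (a : R) (z : R[i]).

Lemma cpow_phase_power z a :
  cpow z (- a) = (phase_power a 0 (complex.Re z) (complex.Im z) +i*
                  phase_power a (- (pi / 2)) (complex.Re z) (complex.Im z))%C.
Proof.
have q0 : 0 <= complex.Re z ^+ 2 + complex.Im z ^+ 2 by rewrite addr_ge0// sqr_ge0.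
have mE : cmodulus z `^ (- a) =
    (complex.Re z ^+ 2 + complex.Im z ^+ 2) `^ (- (a / 2)).
  rewrite -[in RHS](sqr_sqrtr q0) -/(cmodulus z).
  rewrite -(powR_mulrn 2 (sqrtr_ge0 _ : 0 <= cmodulus z)) -powRrM.
  by congr (_ `^ _); field.
apply/eqP; rewrite eq_complex /cpow /= !mul0r subr0 addr0 /phase_power -mE cargE.
apply/andP; split; apply/eqP; congr (_ * _); first by rewrite sub0r mulNr.
by rewrite addrC cosBpihalf mulNr.
Qed.

(** The domain contains the origin, so that the term [mu_0 / z ^ a] of the
    transform is included. *)
Definition phase_transform mu a phi z : R :=
  \int[mu]_(t in E) phase_power a phi (complex.Re z + fine t) (complex.Im z).

Lemma measurable_phase_fine a phi (x y : R) :
  measurable_fun setT (fun t : \bar R => phase_power a phi (x + fine t) y).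
Proof. exact: (measurableT_comp (measurable_phase_power a phi x y) measurable_fine). Qed.

Lemma integrable_phase mu a phi z : 0 < a -> stieltjes_measure a mu ->
  slit_plane z -> mu.-integrable E
    (EFin \o fun t => phase_power a phi (complex.Re z + fine t) (complex.Im z)).
Proof.
move=> a0 [_ inta _] zs; have [C C0 CP] := phase_power_bound phi zs (ltW a0).
have mE := @measurable_ehalf_line R.
have mp : measurable_fun E (fun t : \bar R => (1 + fine t) `^ (- a)).
  apply: measurable_funTS; apply: (@measurableT_comp _ _ _ _ _ _ (@powR R ^~ (- a))).
    exact: measurable_powR.
  by apply: measurable_funD => //; exact: measurable_fine.
have i1 : mu.-integrable E (EFin \o fun t => (1 + fine t) `^ (- a)).
  apply/integrableP; split; first exact/measurable_EFinP.
  apply: le_lt_trans inta; rewrite le_eqVlt; apply/orP; left; apply/eqP.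
  by apply: eq_integral => t _ /=; rewrite ger0_norm ?powR_ge0.
have iC : mu.-integrable E (EFin \o fun t => C * (1 + fine t) `^ (- a)).
  rewrite (_ : _ \o _ = fun t => C%:E * ((1 + fine t) `^ (- a))%:E)%E.
    exact: integrableZl.
  by apply/funext => t /=; rewrite EFinM.
apply: le_integrable iC => //.
  by apply/measurable_EFinP; apply: measurable_funTS; exact: measurable_phase_fine.
move=> t /ehalf_line_fine[t0 _] /=; rewrite lee_fin.
by rewrite [leRHS]ger0_norm ?mulr_ge0 ?powR_ge0// (addrC 1) CP.
Qed.

Lemma stieltjes_transformE mu a z : 0 < a -> stieltjes_measure a mu ->
  slit_plane z ->
  stieltjes_transform a mu z =
  ((phase_transform mu a 0 z + fine (mu [set +oo%E])) +i*
   phase_transform mu a (- (pi / 2)) z)%C.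
Proof.
move=> a0 hmu zs.
have mS1 : measurable [set 0%E : \bar R] by exact: emeasurable_set1.
have mS2 : measurable [set u : \bar R | (0 < u < +oo)%E].
  rewrite (_ : [set u | _] = [set` `]0%E, +oo%E[ ]); first exact: emeasurable_itv.
  by apply/seteqP; split => t /=; rewrite in_itv.
have EU : E = [set 0%E : \bar R] `|` [set u : \bar R | (0 < u < +oo)%E].
  apply/seteqP; split => t /=.
    by rewrite le_eqVlt => /andP[/orP[/eqP <-|->] ->]; [left|right].
  by move=> [->|/andP[/ltW -> ->]] //; rewrite lexx ltry.
have split_phase phi : phase_transform mu a phi z =
    \int[mu]_(u in [set u : \bar R | (0 < u < +oo)%E])
      phase_power a phi (complex.Re z + fine u) (complex.Im z) +
    fine (mu [set 0%E]) * phase_power a phi (complex.Re z) (complex.Im z).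
  rewrite /phase_transform EU Rintegral_setU//; last 2 first.
  - by rewrite -EU; exact: integrable_phase.
  - by apply/disj_set2P; apply/seteqP; split => t //= [-> /andP[]]; rewrite ltxx.
  rewrite addrC; congr (_ + _); rewrite mulrC -Rintegral_cst//.
  by apply: eq_Rintegral => t /[!inE]/= ->; rewrite addr0.
have cE (u : R) : cpow (u%:C%C + z) (- a) =
    (phase_power a 0 (complex.Re z + u) (complex.Im z) +i*
     phase_power a (- (pi / 2)) (complex.Re z + u) (complex.Im z))%C.
  by rewrite cpow_phase_power; case: (z) => x y /=; rewrite add0r (addrC x).
rewrite !split_phase /stieltjes_transform /cRintegral cpow_phase_power.
under eq_Rintegral do rewrite cE.
under [X in (_ +i* X)%C]eq_Rintegral do rewrite cE.
apply/eqP; rewrite eq_complex /=; apply/andP; split; apply/eqP; first by ring.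
by ring.
Qed.

Lemma stieltjes_transform_pos mu a x : 0 < a -> stieltjes_measure a mu -> 0 < x ->
  complex.Re (stieltjes_transform a mu x%:C%C) =
  \int[mu]_(t in E) ((fine t + x) `^ (- a)) + fine (mu [set +oo%E]).
Proof.
move=> a0 hmu x0; rewrite stieltjes_transformE//=; last by move=> /= [_]; lra.
congr (_ + _); apply: eq_Rintegral => t /[!inE] /ehalf_line_fine[t0 _] /=.
rewrite /phase_power /half_angle_arg mul0r atan0 !mulr0 subr0 cos0 mulr1.
rewrite expr0n addr0 -powR_mulrn; last by lra.
by rewrite -powRrM addrC; congr (_ `^ _); field.
Qed.

End transform.

(** * A smaller order gives a monotone potential *)

Section composition_of_kernels.
Context {R : realType}.
Local Notation leb := (@lebesgue_measure R).

Lemma measurable_fractional_kernel_translate (d u : R) :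
  measurable_fun setT (fun t : measurableTypeR R => fractional_kernel d (t - u)).
Proof.
apply: (measurableT_comp (measurable_fractional_kernel d)).
by apply: measurable_funB.
Qed.

Lemma measurable_fractional_kernel_reflect (d y : R) :
  measurable_fun setT (fun t : measurableTypeR R => fractional_kernel d (y - t)).
Proof.
apply: (measurableT_comp (measurable_fractional_kernel d)).
by apply: measurable_funB.
Qed.

Lemma measurable_kernel_average (d : R) (k : R -> R) :
    measurable_fun setT (k : measurableTypeR R -> R) -> (forall y, 0 <= k y) ->
  measurable_fun setT (fun u : measurableTypeR R =>
    \int[leb]_y (fractional_kernel d (y - u) * k y)%:E)%E.
Proof.
move=> mk k0.
apply: (@measurable_fun_fubini_tonelli_F _ _ (measurableTypeR R) (measurableTypeR R)
  R leb (fun z => (fractional_kernel d (z.2 - z.1) * k z.2)%:E)).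
  apply/measurable_EFinP; apply: measurable_funM.
    apply: (measurableT_comp (measurable_fractional_kernel d)).
    exact: measurable_funB.
  exact: (measurableT_comp mk).
by move=> z; rewrite lee_fin mulr_ge0// fractional_kernel_ge0.
Qed.

Lemma fractional_kernelZ (d r s : R) : 0 < r ->
  fractional_kernel d (r * s) = r `^ (d - 1) * fractional_kernel d s.
Proof.
move=> r0; rewrite /fractional_kernel pmulr_rgt0//.
by case: ifPn => s0; rewrite ?mulr0// powRM// ltW.
Qed.

(** Both kernels are homogeneous: the dilation by [y - u] reduces to [u = 0] and
    [y = 1], where the integral is a constant, possibly infinite. *)
Lemma fractional_kernel_convolution (d e u y : R) : u < y ->
  (\int[leb]_t (fractional_kernel d (t - u) * fractional_kernel e (y - t))%:E =
   ((y - u) `^ (d + e - 1))%:E *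
   \int[leb]_t (fractional_kernel d t * fractional_kernel e (1 - t))%:E)%E.
Proof.
move=> uy; have L0 : 0 < y - u by rewrite subr_gt0.
have mk d' : measurable_fun setT (fractional_kernel d' : measurableTypeR R -> R).
  exact: measurable_fractional_kernel.
rewrite (@ge0_integral_affine _ _ u L0); first last.
- by move=> t; rewrite lee_fin mulr_ge0// fractional_kernel_ge0.
- apply/measurable_EFinP; apply: measurable_funM.
    exact: measurable_fractional_kernel_translate.
  exact: measurable_fractional_kernel_reflect.
have -> : (y - u) `^ (d + e - 1) = (y - u) * ((y - u) `^ (d - 1) * (y - u) `^ (e - 1)).
  rewrite -powRD ?(gt_eqF L0) ?implybT//.
  rewrite -[X in _ = X * _](powRr1 (ltW L0)) -powRD ?(gt_eqF L0) ?implybT//.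
  by congr (_ `^ _); ring.
rewrite [in RHS]EFinM -muleA; congr (_ * _)%E.
rewrite -ge0_integralZl//; first last.
- by rewrite lee_fin mulr_ge0// powR_ge0.
- by move=> t _; rewrite lee_fin mulr_ge0// fractional_kernel_ge0.
- apply/measurable_EFinP; apply: measurable_funM; first exact: mk.
  exact: measurable_fractional_kernel_reflect.
apply: eq_integral => t _; rewrite -EFinM; congr EFin.
rewrite addrK (_ : y - ((y - u) * t + u) = (y - u) * (1 - t)); last by ring.
by rewrite !fractional_kernelZ//; ring.
Qed.

Lemma fractional_kernel_convolution_ge0 (d e u y : R) :
  (0 <= \int[leb]_t (fractional_kernel d (t - u) * fractional_kernel e (y - t))%:E)%E.
Proof.
by apply: integral_ge0 => t _; rewrite lee_fin mulr_ge0// fractional_kernel_ge0.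
Qed.

Lemma fractional_kernel_convolution_homo (d e u x y : R) : 1 <= d + e -> x <= y ->
  (\int[leb]_t (fractional_kernel d (t - u) * fractional_kernel e (x - t))%:E <=
   \int[leb]_t (fractional_kernel d (t - u) * fractional_kernel e (y - t))%:E)%E.
Proof.
move=> de xy; have [xu|ux] := leP x u.
  rewrite integral0_eq ?fractional_kernel_convolution_ge0// => t _.
  rewrite /fractional_kernel; case: ifPn => ht; last by rewrite mul0r.
  by case: ifPn => ht'; [exfalso; lra|rewrite mulr0].
rewrite !fractional_kernel_convolution//; last exact: lt_le_trans xy.
apply: lee_wpmul2r.
  by apply: integral_ge0 => t _; rewrite lee_fin mulr_ge0// fractional_kernel_ge0.
by rewrite lee_fin; apply: ge0_ler_powR; rewrite ?nnegrE; lra.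
Qed.

End composition_of_kernels.

Section smaller_order.
Context {R : realType}.
Local Notation leb := (@lebesgue_measure R).
Local Notation D := (`[0, +oo[%classic : set (measurableTypeR R)).
Local Notation E := [set t : \bar R | (0 <= t < +oo)%E].

Lemma fractional_potentialE (mu : {measure set (\bar R) -> \bar R})
    (sg : {measure set (measurableTypeR R) -> \bar R}) (eps y : R) :
    (forall g : R -> \bar R, measurable_fun setT g -> (forall u, 0 <= g u)%E ->
      (\int[sg]_(u in D) g u = \int[mu]_(t in E) g (fine t))%E) ->
  fractional_potential mu eps y = fractional_integral (1 - eps) sg y.
Proof.
move=> sgE; rewrite /fractional_integral sgE; last 2 first.
- by apply/measurable_EFinP; exact: measurable_fractional_kernel_reflect.
- by move=> u; rewrite lee_fin fractional_kernel_ge0.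
rewrite /fractional_potential integral_mkcond [RHS]integral_mkcond.
apply: eq_integral => t _; rewrite !patchE /fractional_kernel subr_gt0.
have [tE|tE] := boolP (t \in E); last first.
  rewrite ifF//; apply/negbTE; apply: contra tE; rewrite !inE/= => /andP[-> ty].
  exact: lt_trans (ltry y).
have tf : t = (fine t)%:E by move: tE; rewrite inE => /ehalf_line_fine[].
have -> : (t \in [set u | (0 <= u < y%:E)%E]) = (fine t < y).
  move: tE; rewrite inE/= => /andP[t0 _].
  apply/idP/idP; first by rewrite inE/= t0/= tf lte_fin.
  by rewrite inE/= t0/= [in X in _ -> X]tf lte_fin.
case: ifP => // _; congr (EFin (_ `^ _)); ring.
Qed.

Lemma half_line_cauchy (mu : {measure set (\bar R) -> \bar R})
    (sg : {measure set (measurableTypeR R) -> \bar R}) (a : R) :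
    0 < a -> stieltjes_measure a mu ->
    (forall g : R -> \bar R, measurable_fun setT g -> (forall u, 0 <= g u)%E ->
      (\int[sg]_(u in D) g u = \int[mu]_(t in E) g (fine t))%E) ->
  cauchy_integrable sg a /\
  forall x, 0 < x -> complex.Re (stieltjes_transform a mu x%:C%C) =
    cauchy_moment sg a x + fine (mu [set +oo%E]).
Proof.
move=> a0 hmu sgE; split.
  rewrite /cauchy_integrable sgE.
  - by have [_ + _] := hmu; under eq_integral do rewrite addrC.
  - by apply/measurable_EFinP; exact: measurable_powR_translate.
  - by move=> u; rewrite lee_fin powR_ge0.
move=> x x0; rewrite stieltjes_transform_pos//; congr (_ + _).
rewrite /cauchy_moment /Rintegral sgE//.
- by apply/measurable_EFinP; exact: measurable_powR_translate.
- by move=> u; rewrite lee_fin powR_ge0.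
Qed.

Section monotone_potential.
Variables (a b : R) (nu sg : {sigma_finite_measure set (measurableTypeR R) -> \bar R}).
Variable c : R.
Hypotheses (a_gt0 : 0 < a) (a_lt_b : a < b).
Hypotheses (int_nu : cauchy_integrable nu a) (int_sg : cauchy_integrable sg b).
Hypothesis same_transform : forall x, 0 < x ->
  cauchy_moment sg b x = cauchy_moment nu a x + c.

Let B := beta_constant (b - a) b.
Let ba0 : 0 < b - a. Proof. by rewrite subr_gt0. Qed.
Let B0 : 0 < B.
Proof. by apply: beta_constant_gt0 => //; rewrite ltrBlDr ltrDl. Qed.

Let dens (y : R) : \bar R := ((B^-1)%:E * fractional_integral (b - a) nu y)%E.

Let mdens : measurable_fun setT (dens : measurableTypeR R -> \bar R).
Proof. by apply: emeasurable_funM => //; exact: measurable_fractional_integral. Qed.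

Let dens0 y : (0 <= dens y)%E.
Proof. by rewrite mule_ge0 ?fractional_integral_ge0// lee_fin invr_ge0 ltW. Qed.

Let dens_nonpos y : y <= 0 -> dens y = 0%E.
Proof.
by move=> y0; rewrite /dens fractional_integral_nonpos// mule0.
Qed.

Let integral_dens (g : R -> R) : measurable_fun setT (g : measurableTypeR R -> R) ->
    (forall u, 0 <= g u) ->
  (\int[leb]_y ((g y)%:E * dens y) = (B^-1)%:E *
   \int[nu]_(u in D) \int[leb]_y (fractional_kernel (b - a) (y - u) * g y)%:E)%E.
Proof.
move=> mg g0; rewrite tonelli_fractional_integral//.
rewrite -ge0_integralZl//.
- by apply: eq_integral => y _; rewrite /dens muleCA.
- apply: emeasurable_funM; first exact/measurable_EFinP.
  exact: measurable_fractional_integral.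
- by move=> y _; rewrite mule_ge0 ?fractional_integral_ge0// lee_fin.
- by rewrite lee_fin invr_ge0 ltW.
Qed.

(* By uniqueness, [sg] has the density [dens] on the half-line. *)
Let representing (g : R -> R) : measurable_fun setT (g : measurableTypeR R -> R) ->
    (forall u, 0 <= g u) ->
  (\int[sg]_(u in D) (g u)%:E = (B^-1)%:E *
   \int[nu]_(u in D) \int[leb]_y (fractional_kernel (b - a) (y - u) * g y)%:E)%E.
Proof.
have [m [_ mint]] := density_measure leb mdens dens0.
have mE (h : R -> R) : measurable_fun setT (h : measurableTypeR R -> R) ->
    (forall u, 0 <= h u) ->
    (\int[m]_(u in D) (h u)%:E = (B^-1)%:E *
     \int[nu]_(u in D) \int[leb]_y (fractional_kernel (b - a) (y - u) * h y)%:E)%E.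
  move=> mh h0; rewrite -integral_dens// integral_mkcond mint.
  - apply: eq_integral => y _; rewrite patchE; case: ifPn => // yD.
    rewrite mul0e dens_nonpos ?mule0//.
    by move: yD; rewrite notin_setE/= in_itv/= andbT => /negP; rewrite -ltNge => /ltW.
  - apply/(measurable_restrictT _ _).1; first exact: measurable_itv.
    by apply: measurable_funTS; exact/measurable_EFinP.
  - by move=> y; rewrite patchE; case: ifP => _ //; rewrite lee_fin.
have kernelE x : 0 < x -> (\int[m]_(u in D) ((u + x) `^ (- b))%:E =
    \int[nu]_(u in D) ((u + x) `^ (- a))%:E)%E.
  move=> x0; rewrite mE; last 2 first.
  - exact: measurable_powR_translate.
  - by move=> u; exact: powR_ge0.
  rewrite -ge0_integralZl//.
  - apply: eq_integral => u /[!inE]/=; rewrite in_itv/= andbT => u0.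
    rewrite fractional_integral_powR//; last by rewrite ltrBlDr ltrDl.
    by rewrite -EFinM mulrA mulVf ?gt_eqF// mul1r subKr.
  - apply: measurable_funTS; apply: measurable_kernel_average.
      exact: measurable_powR_translate.
    by move=> y; exact: powR_ge0.
  - by move=> u _; apply: integral_ge0 => y _; rewrite lee_fin mulr_ge0 ?powR_ge0 ?fractional_kernel_ge0.
  - by rewrite lee_fin invr_ge0 ltW.
move=> mg g0; rewrite -mE//.
apply: (@stieltjes_uniqueness _ sg m b c) => //.
- exact: lt_trans a_lt_b.
- by rewrite /cauchy_integrable kernelE.
- by move=> x x0; rewrite same_transform// /cauchy_moment /Rintegral kernelE.
- exact/measurable_EFinP.
Qed.

(** The density of [sg] is a multiple of the fractional integral of order [b - a]
    of [nu]; so the potential of [sg] is an integral against [nu] of convolutions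
    of kernels, multiples of powers of [y - u] of exponent [b - a - eps >= 0]. *)
Lemma fractional_integral_homo (eps : R) : 0 <= eps -> eps <= b - a ->
  {homo fractional_integral (1 - eps) sg : x y / x <= y >-> (x <= y)%E}.
Proof.
move=> e0 eba x y xy.
rewrite /fractional_integral !representing; try
  (by move=> u; exact: fractional_kernel_ge0);
  try exact: measurable_fractional_kernel_reflect.
apply: lee_wpmul2l; first by rewrite lee_fin invr_ge0 ltW.
have mT z : measurable_fun D (fun u : measurableTypeR R => \int[leb]_t
    (fractional_kernel (b - a) (t - u) * fractional_kernel (1 - eps) (z - t))%:E)%E.
  apply: measurable_funTS; apply: measurable_kernel_average.
    exact: measurable_fractional_kernel_reflect.
  by move=> t; exact: fractional_kernel_ge0.
apply: ge0_le_integral.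
- exact: measurable_itv.
- by move=> u _; exact: fractional_kernel_convolution_ge0.
- exact: mT.
- exact: mT.
- by move=> u _; apply: fractional_kernel_convolution_homo => //; lra.
Qed.

End monotone_potential.

End smaller_order.

Section smaller_order_monotone.
Context {R : realType}.
Local Notation D := (`[0, +oo[%classic : set (measurableTypeR R)).

(** In the case [a = 0] of constants, the zero measure has any exponent. *)
Lemma stieltjes_class_cauchy (f : R[i] -> R[i]) (a b : R) :
    0 < b -> a < b -> stieltjes_class a f ->
  exists a' (nu : {sigma_finite_measure set (measurableTypeR R) -> \bar R}) c,
    [/\ 0 < a', a' < b, cauchy_integrable nu a' &
        forall x, 0 < x -> complex.Re (f x%:C%C) = cauchy_moment nu a' x + c].
Proof.
have pos (x : R) : 0 < x -> slit_plane (x%:C%C : R[i]).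
  by move=> x0 /= [_]; rewrite leNgt x0.
move=> b0 ab [[_ [c c0 fE]]|[a0 [nu' [hnu fE]]]].
  exists (b / 2), mzero, c; split; try lra.
    by rewrite /cauchy_integrable integral_measure_zero.
  move=> x x0; rewrite fE; last exact: pos.
  by rewrite /cauchy_moment /Rintegral integral_measure_zero/= add0r.
have [nu nuE] := half_line_measure a0 hnu.
have [inu tnu] := half_line_cauchy a0 hnu nuE.
exists a, nu, (fine (nu' [set +oo%E])); split => // x x0.
by rewrite fE ?tnu//; exact: pos.
Qed.

Lemma smaller_order_monotone (b : R) (f : R[i] -> R[i])
    (mu : {measure set (\bar R) -> \bar R}) :
  0 < b -> represents b mu f -> stieltjes_order f < b ->
  exists eps : R, 0 < eps < Num.min b 1 /\
    {in `]0, +oo[ &, {homo fractional_potential mu eps : x y /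
      x <= y >-> (x <= y)%E}}.
Proof.
move=> b0 [hmu fE] fb.
have [|a Sa ab] := inf_lt _ fb.
  by exists b; right; split => //; exists mu.
have [a' [nu [c [a0 a'b inu tnu]]]] := stieltjes_class_cauchy b0 ab Sa.
have [sg sgE] := half_line_measure b0 hmu.
have [isg tsg] := half_line_cauchy b0 hmu sgE.
(* Half of [m] is below [min b 1] and at most [b - a']. *)
pose m := Num.min (b - a') (Num.min b 1).
have m0 : 0 < m by rewrite !lt_min subr_gt0 a'b b0 ltr01.
have m1 : m <= b - a' by rewrite ge_min lexx.
have m2 : m <= Num.min b 1 by rewrite ge_min lexx orbT.
exists (m / 2); split; first by apply/andP; split; lra.
move=> x y _ _ xy; rewrite !(fractional_potentialE _ _ sgE).
apply: (@fractional_integral_homo _ a' b nu sg (c - fine (mu [set +oo%E]))) => //; try lra.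
move=> z z0; have := tsg z z0; rewrite -fE; last by move=> /= [_]; lra.
by rewrite tnu// => e; rewrite addrA e addrK.
Qed.

End smaller_order_monotone.

(** * A monotone potential gives a smaller order *)

Lemma lebesgue_stieltjes_measure_oc {R : realType} (g : cumulative R R) (a b : R) :
  a <= b -> lebesgue_stieltjes_measure g `]a, b]%classic = (g b - g a)%:E.
Proof.
move=> ab; rewrite /lebesgue_stieltjes_measure /measure_extension/=.
by rewrite measurable_mu_extE/=; [rewrite wlength_itv_bnd|exact: is_ocitv].
Qed.

Section measure_of_monotone_function.
Context {R : realType}.
Local Notation leb := (@lebesgue_measure R).
Variable phi : R -> R.
Hypothesis phi_ge0 : forall x, 0 < x -> 0 <= phi x.
Hypothesis phi_nd : forall x y, 0 < x -> x <= y -> phi x <= phi y.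

(* The right-continuous version of [phi], extended by [0]. *)
Let F (y : R) : R := if y < 0 then 0 else inf [set phi t | t in `]y, +oo[].

Let S_nonempty (y : R) : [set phi t | t in `]y, +oo[] !=set0.
Proof. by exists (phi (y + 1)), (y + 1) => //=; rewrite in_itv/= ltrDl ltr01. Qed.

Let S_lbound (y : R) : 0 <= y -> lbound [set phi t | t in `]y, +oo[] 0.
Proof.
move=> y0 _ [t /= + <-]; rewrite in_itv/= andbT => yt.
by apply: phi_ge0; exact: le_lt_trans yt.
Qed.

Let F_le (y t : R) : 0 <= y -> y < t -> F y <= phi t.
Proof.
move=> y0 yt; rewrite /F ltNge y0/=.
apply: ge_inf; first by exists 0; exact: S_lbound.
by exists t => //=; rewrite in_itv/= yt.
Qed.

Let F_ge (y c : R) : 0 <= y -> (forall t, y < t -> c <= phi t) -> c <= F y.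
Proof.
move=> y0 h; rewrite /F ltNge y0/=; apply: lb_le_inf; first exact: S_nonempty.
by move=> _ [t /= + <-]; rewrite in_itv/= andbT; exact: h.
Qed.

Let F_ge0 y : 0 <= F y.
Proof.
have [y0|y0] := leP 0 y; last by rewrite /F y0.
by apply: F_ge => // t yt; apply: phi_ge0; exact: le_lt_trans yt.
Qed.

Let F_nd : nondecreasing F.
Proof.
move=> x y xy; have [x0|x0] := leP 0 x; last by rewrite {1}/F x0 F_ge0.
apply: F_ge; first exact: le_trans xy.
by move=> t yt; apply: F_le => //; exact: le_lt_trans yt.
Qed.

Let F_rc : right_continuous F.
Proof.
move=> y; have [y0|y0] := leP 0 y; last first.
  rewrite {2}/F y0; apply: cvg_near_cst; near=> x.
  by rewrite /F ifT//; near: x; exact: nbhs_right_lt.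
apply/cvgrPdist_lt => e e0.
have [t yt te] : exists2 t, y < t & phi t < F y + e.
  have h : has_inf [set phi t | t in `]y, +oo[].
    by split; [exact: S_nonempty|exists 0; exact: S_lbound].
  have [_ [t /= + <-] te] := inf_adherent e0 h.
  rewrite in_itv/= andbT => yt; exists t => //.
  by rewrite /F (ltNge y 0) y0.
near=> x.
have yx : y < x by near: x; exact: nbhs_right_gt.
have xt : x < t by near: x; exact: nbhs_right_lt.
have h1 := F_nd (ltW yx); have h2 : F x <= phi t by apply: F_le => //; lra.
by rewrite ler0_norm; lra.
Unshelve. all: end_near. Qed.

Let cF : cumulative R R := HB.pack F (isCumulative.Build _ _ _ F F_nd F_rc).

Let nu : {sigma_finite_measure set (measurableTypeR R) -> \bar R} :=
  lebesgue_stieltjes_measure cF.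

Let nu_oc (a b : R) : a <= b -> nu `]a, b]%classic = (F b - F a)%:E.
Proof. exact: (lebesgue_stieltjes_measure_oc cF). Qed.

(* Masses of [[0, y[] are compared with increments of [F] from [-1]. *)
Let nu_neg : nu `]-1, 0[%classic = 0%E.
Proof.
apply: measure_negligible; first exact: measurable_itv.
have -> : `]-1, 0[%classic = \bigcup_n `]-1, - n.+1%:R^-1]%classic :> set R.
  apply/seteqP; split => x /=.
    rewrite in_itv/= => /andP[x1 x0].
    exists (Num.truncn (- x)^-1) => //=; rewrite in_itv/= x1/= lerNr.
    rewrite -[leRHS]invrK lef_pV2 ?posrE ?invr_gt0 ?oppr_gt0//.
    exact/ltW/truncnS_gt.
  move=> [n _ /=]; rewrite !in_itv/= => /andP[-> h] /=.
  by apply: le_lt_trans h _; rewrite oppr_lt0 invr_gt0.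
apply: negligible_bigcup => n; apply/negligibleP; first exact: measurable_itv.
have n1 : n.+1%:R^-1 <= 1 :> R by rewrite invf_le1// ler1n.
have n0 : 0 < n.+1%:R^-1 :> R by rewrite invr_gt0.
have F0 : F (- n.+1%:R^-1) = 0 by rewrite /F oppr_lt0 n0.
apply: (etrans (nu_oc _)); first by rewrite lerN2.
by rewrite F0 /F ltrN10 subr0.
Qed.

Let Fm1 : F (-1) = 0. Proof. by rewrite /F ltrN10. Qed.

Let nu_le (y t : R) : 0 < y -> y < t -> (nu `[0%R, y[%classic <= (phi t)%:E)%E.
Proof.
move=> y0 yt; apply: (@le_trans _ _ (F y)%:E); last by rewrite lee_fin F_le// ltW.
have -> : (F y)%:E = nu `](-1), y]%classic by rewrite nu_oc ?Fm1 ?subr0//; lra.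
apply: le_measure; rewrite ?inE; [exact: measurable_itv|exact: measurable_itv|].
by move=> x /=; rewrite !in_itv/= => /andP[x0 xy]; apply/andP; split; lra.
Qed.

Let nu_ge (y t : R) : 0 < t -> t < y -> ((phi t)%:E <= nu `[0%R, y[%classic)%E.
Proof.
move=> t0 ty; apply: (@le_trans _ _ (F t)%:E).
  rewrite lee_fin; apply: F_ge; first exact: ltW.
  by move=> u tu; apply: phi_nd => //; exact: ltW.
have -> : (F t)%:E = nu `](-1), t]%classic by rewrite nu_oc ?Fm1 ?subr0//; lra.
have m1 : measurable (`]-1, 0[%classic : set (measurableTypeR R)) by exact: measurable_itv.
have m2 : measurable (`[0, y[%classic : set (measurableTypeR R)) by exact: measurable_itv.
apply: (@le_trans _ _ (nu (`]-1, 0[ `|` `[0%R, y[))).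
  apply: le_measure; rewrite ?inE; [exact: measurable_itv|exact: measurableU|].
  move=> x /=; rewrite !in_itv/= => /andP[x0 xy].
  by have [h|h] := ltP x 0; [left|right]; apply/andP; split; lra.
rewrite -[leRHS]add0e -nu_neg; exact: measureU2.
Qed.

Let nu_continuity_point (y : R) : 0 < y -> ~ discontinuity phi y ->
  nu `[0%R, y[%classic = (phi y)%:E.
Proof.
move=> y0 cy.
have h2y : 0 < y / 2 by lra.
have hy2 : y / 2 < y by lra.
have cl : cvg (phi x @[x --> y^'-]).
  apply: nondecreasing_at_left_is_cvgr.
    near=> a => u v; rewrite !in_itv/= => /andP[au _] _ uv; apply: phi_nd => //.
    by apply: le_lt_trans au; near: a; apply: nbhs_left_ge.
  near=> a; exists (phi y) => _ [u /= + <-]; rewrite in_itv/= => /andP[au uy].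
  apply: phi_nd; last exact: ltW.
  by apply: le_lt_trans au; near: a; apply: nbhs_left_ge.
have cr : cvg (phi x @[x --> y^'+]).
  apply: nondecreasing_at_right_is_cvgr.
    near=> a => u v; rewrite !in_itv/= => /andP[yu _] _ uv; apply: phi_nd => //.
    exact: lt_trans yu.
  near=> a; exists (phi y) => _ [u /= + <-]; rewrite in_itv/= => /andP[yu ua].
  by apply: phi_nd => //; exact: ltW.
have lr : lim (phi x @[x --> y^'-]) = lim (phi x @[x --> y^'+]).
  by apply/eqP; apply: contra_notT cy => lr; split.
have yy1 : y < y + 1 by lra.
have nuy_fin : nu `[0%R, y[%classic \is a fin_num.
  rewrite ge0_fin_numE//.
  by apply: le_lt_trans (nu_le y0 yy1) _; rewrite ltry.
rewrite -(fineK nuy_fin); congr EFin.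
set i := fine _.
have iE : nu `[0%R, y[%classic = i%:E by rewrite fineK.
have le_i : lim (phi x @[x --> y^'-]) <= i.
  apply: limr_le => //; near=> x.
  have x0 : 0 < x by near: x; exact: nbhs_left_gt.
  have xy : x < y by near: x; exact: nbhs_left_lt.
  by rewrite -lee_fin -iE nu_ge.
have ge_i : i <= lim (phi x @[x --> y^'+]).
  apply: limr_ge => //; near=> x.
  have yx : y < x by near: x; exact: nbhs_right_gt.
  by rewrite -lee_fin -iE nu_le.
have le_p : lim (phi x @[x --> y^'-]) <= phi y.
  apply: limr_le => //; near=> x.
  have x0 : 0 < x by near: x; exact: nbhs_left_gt.
  have xy : x < y by near: x; exact: nbhs_left_lt.
  exact: phi_nd (ltW xy).
have ge_p : phi y <= lim (phi x @[x --> y^'+]).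
  apply: limr_ge => //; near=> x.
  have yx : y < x by near: x; exact: nbhs_right_gt.
  exact: phi_nd (ltW yx).
by apply/eqP; rewrite eq_le; apply/andP; split; lra.
Unshelve. all: end_near. Qed.

(** At a continuity point [y], the mass of [[0, y[] is squeezed between the values
    of [phi] on both sides of [y]; a monotone function has only countably many
    discontinuities. *)
Lemma measure_of_monotone_function :
  exists m : {sigma_finite_measure set (measurableTypeR R) -> \bar R},
    {ae leb, forall y, 0 < y -> m `[0%R, y[%classic = (phi y)%:E}.
Proof.
exists nu.
pose A := \bigcup_n [set x | x \in (`]n.+2%:R^-1, n.+2%:R[) /\ discontinuity phi x].
have cA : countable A.
  apply: bigcup_countable => // n _; apply: discontinuity_countable.
  move=> u v; rewrite !in_itv/= => /andP[nu' _] _ uv; apply: phi_nd => //.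
  by apply: lt_le_trans nu'; rewrite invr_gt0.
have mA : measurable (A : set (measurableTypeR R)).
  by apply: countable_measurable => // t; exact: measurable_set1.
exists A; split => //; first exact: countable_lebesgue_measure0.
move=> y /=; apply: contra_notP => nA y0; apply: nu_continuity_point => // dy.
apply: nA; pose n := maxn (Num.truncn y) (Num.truncn y^-1).
exists n => //; split => //; rewrite in_itv/=; apply/andP; split.
  rewrite -[ltRHS]invrK ltf_pV2 ?posrE ?invr_gt0//.
  apply: lt_le_trans (truncnS_gt _) _.
  by rewrite ler_nat ltnS /n (leq_trans (leq_maxr _ _) (leqnSn _)).
apply: lt_le_trans (truncnS_gt _) _.
by rewrite ler_nat ltnS /n (leq_trans (leq_maxl _ _) (leqnSn _)).
Qed.

End measure_of_monotone_function.

Section smaller_exponent.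
Context {R : realType}.
Local Notation leb := (@lebesgue_measure R).
Local Notation D := (`[0, +oo[%classic : set (measurableTypeR R)).
Local Notation E := [set t : \bar R | (0 <= t < +oo)%E].

Lemma compactified_measure (nu : {measure set (measurableTypeR R) -> \bar R}) (c : R) :
    0 <= c ->
  exists mu : {measure set (\bar R) -> \bar R},
    [/\ mu [set t | (t < 0)%E] = 0%E, mu [set +oo%E] = c%:E &
     forall g : R -> \bar R, measurable_fun setT g -> (forall u, 0 <= g u)%E ->
      (\int[nu]_(u in D) g u = \int[mu]_(t in E) g (fine t))%E].
Proof.
move=> c0; have mD : measurable D by exact: measurable_itv.
have mE := @measurable_ehalf_line R.
have mS : measurable [set +oo%E : \bar R] by exact: emeasurable_set1.
have mN : measurable [set t : \bar R | (t < 0)%E].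
  rewrite (_ : [set t | _] = [set` `]-oo, 0%E[ ]); first exact: emeasurable_itv.
  by apply/seteqP; split => t /=; rewrite in_itv.
have mD1 : measurable_fun setT (fun u : measurableTypeR R => (\1_D u)%:E : \bar R).
  by apply/measurable_EFinP; exact: measurable_indic.
have [m [mA mint]] := density_measure nu mD1 (fun u => ltac:(by rewrite lee_fin)).
have mEFin : measurable_fun setT (EFin : measurableTypeR R -> \bar R).
  exact: EFin_measurable.
have mpre (A : set (\bar R)) : measurable A ->
    measurable ((EFin : measurableTypeR R -> \bar R) @^-1` A).
  by move=> mA'; have := mEFin measurableT A mA'; rewrite setTI.
pose m1 := image_measure m mEFin.
pose m2 : {measure set (\bar R) -> \bar R} := mscale (NngNum c0) (dirac +oo%E).
pose mu : {measure set (\bar R) -> \bar R} := measure_add m1 m2.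
have muE A : mu A = (m1 A + m2 A)%E by exact: measure_addE.
exists mu; split.
- rewrite muE /m1 /= /pushforward mA; last exact: mpre.
  rewrite /m2 /mscale/= diracE memNset// mule0 adde0.
  apply: integral0_eq => u /=; rewrite lte_fin => u0.
  by rewrite indicE memNset//= in_itv/= andbT leNgt u0.
- rewrite muE /m1 /= /pushforward mA; last exact: mpre.
  rewrite /m2 /mscale/= diracE mem_set// mule1 integral0_eq ?add0e//.
- move=> g mg g0.
  have mgf : measurable_fun E (g \o fine).
    by apply: measurable_funTS; exact: (measurableT_comp mg (@measurable_fine R)).
  rewrite ge0_integral_measure_add//.
  rewrite ge0_integral_mscale//.
  rewrite integral_dirac// diracE memNset ?mul0e ?mule0 ?adde0; last first.
    by rewrite /= ltxx andbF.
  rewrite (ge0_integral_pushforward mEFin)//.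
  rewrite [RHS]integral_mkcond mint; last 2 first.
  + apply/(measurable_restrictT _ _).1.
      exact: mpre.
    exact: measurable_funTS.
  + by move=> t; rewrite patchE; case: ifP => // _; exact: g0.
  rewrite [LHS]integral_mkcond; apply: eq_integral => u _; rewrite !patchE indicE.
  have [uD|uD] := boolP (u \in D); last by rewrite mule0.
  rewrite mule1 mem_set//=; move: uD; rewrite inE/= in_itv/= andbT => u0.
  by rewrite lee_fin u0 ltry.
Qed.

Section phase.
Variables (sg : {sigma_finite_measure set (measurableTypeR R) -> \bar R}) (d g : R).
Hypotheses (d_gt0 : 0 < d) (d_lt_g : d < g).
Hypothesis int_sg : cauchy_integrable sg (g - d).

Lemma tonelli_powR (x : R) : 0 < x ->
  (\int[sg]_(u in D) (beta_constant d g * (u + x) `^ (- (g - d)))%:E =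
   \int[leb]_y (((y + x) `^ (- g))%:E * fractional_integral d sg y))%E.
Proof.
move=> x0; rewrite -tonelli_fractional_integral; last 2 first.
- exact: measurable_powR_translate.
- by move=> y; exact: powR_ge0.
apply: eq_integral => u /[!inE]/=; rewrite in_itv/= andbT => u0.
by rewrite fractional_integral_powR.
Qed.

Let powR_lty (c x : R) : 0 <= c -> 0 < x ->
  (\int[sg]_(u in D) (c * (u + x) `^ (- (g - d)))%:E < +oo)%E.
Proof.
move=> c0 x0; have gd : 0 <= g - d by rewrite subr_ge0 ltW.
have := integrable_cauchy gd int_sg (lexx _) x0.
have mD : measurable D by exact: measurable_itv.
move=> /(integrableZl mD c) /integrableP[_]; apply: le_lt_trans.
rewrite le_eqVlt; apply/orP; left; apply/eqP; apply: eq_integral => u _ /=.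
by rewrite ger0_norm// mulr_ge0// powR_ge0.
Qed.

Lemma fractional_integral_weighted_lty :
  (\int[leb]_y (((y + 1) `^ (- g))%:E * fractional_integral d sg y) < +oo)%E.
Proof.
rewrite -tonelli_powR//; apply: powR_lty => //.
by rewrite ltW// beta_constant_gt0.
Qed.

(** Fubini applies because the power of exponent [g] is dominated by a multiple
    of [(y + 1) ^ - g], whose integral against the fractional integral is
    finite. *)
Lemma fubini_phase (c phi : R) (w : R[i]) : slit_plane w ->
  (\int[sg]_(u in D) (c * beta_constant d g *
     phase_power (g - d) phi (complex.Re w + u) (complex.Im w))%:E =
   \int[leb]_y ((c * phase_power g phi (complex.Re w + y) (complex.Im w))%:E *
     fractional_integral d sg y))%E.
Proof.
move=> ws; have g0 : 0 <= g by apply: ltW; exact: lt_trans d_lt_g.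
have [C C0 CP] := phase_power_bound phi ws g0.
have B0 : 0 < beta_constant d g by exact: beta_constant_gt0.
have mp : measurable_fun setT (fun y : measurableTypeR R =>
    c * phase_power g phi (complex.Re w + y) (complex.Im w)).
  by apply: measurable_funM => //; exact: measurable_phase_power.
have mk : measurable_fun setT (fun y : measurableTypeR R =>
    phase_power g phi (complex.Re w + y) (complex.Im w)).
  exact: measurable_phase_power.
have mK u : measurable_fun setT (fun y : measurableTypeR R => fractional_kernel d (y - u)).
  exact: measurable_fractional_kernel_translate.
have bound u : 0 <= u -> (\int[leb]_y (fractional_kernel d (y - u) *
     `|phase_power g phi (complex.Re w + y) (complex.Im w)|)%:E <=
   (C * (beta_constant d g * (u + 1) `^ (- (g - d))))%:E)%E.
  move=> u0; rewrite EFinM -(fractional_integral_powR d_gt0 d_lt_g ltr01 u0).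
  have mKp : measurable_fun setT (fun y : measurableTypeR R =>
      fractional_kernel d (y - u) * (y + 1) `^ (- g)).
    by apply: measurable_funM => //; exact: measurable_powR_translate.
  rewrite -ge0_integralZl//; last 2 first.
  - exact/measurable_EFinP.
  - by move=> y _; rewrite lee_fin mulr_ge0 ?powR_ge0// fractional_kernel_ge0.
  apply: ge0_le_integral => //.
  - by move=> y _; rewrite lee_fin mulr_ge0// fractional_kernel_ge0.
  - apply/measurable_EFinP; apply: measurable_funM => //.
    exact: measurableT_comp.
  - by apply/measurable_EFinP; apply: measurable_funM.
  move=> y _; rewrite -EFinM lee_fin mulrCA.
  rewrite /fractional_kernel; case: ifPn => yu; last by rewrite !mul0r.
  by apply: ler_wpM2l; [exact: powR_ge0|apply: CP; lra].
have intk u : 0 <= u -> leb.-integrable setT (EFin \o fun y =>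
    fractional_kernel d (y - u) * phase_power g phi (complex.Re w + y) (complex.Im w)).
  move=> u0; apply/integrableP; split.
    by apply/measurable_EFinP; exact: measurable_funM.
  apply: le_lt_trans (ltry _); apply: le_trans (bound u u0).
  rewrite le_eqVlt; apply/orP; left; apply/eqP; apply: eq_integral => y _ /=.
  by rewrite normrM ger0_norm// fractional_kernel_ge0.
rewrite -(fubini_fractional_integral (d := d) (sg := sg) mp).
  apply: eq_integral => u /[!inE]/=; rewrite in_itv/= andbT => u0.
  rewrite -mulrA EFinM -(fractional_integral_phase_power d_gt0 d_lt_g phi ws u0).
  rewrite -integralZl//; last exact: intk.
  by apply: eq_integral => y _; rewrite -EFinM; congr EFin; ring.
apply: le_lt_trans (powR_lty (_ : 0 <= `|c| * C * beta_constant d g) ltr01); last first.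
  by rewrite !mulr_ge0// ltW.
apply: ge0_le_integral.
- exact: measurable_itv.
- move=> u _; apply: integral_ge0 => y _.
  by rewrite lee_fin mulr_ge0// fractional_kernel_ge0.
- apply: measurable_funTS; apply: measurable_kernel_average => //.
  exact: measurableT_comp.
- apply/measurable_EFinP; apply: measurable_funTS; apply: measurable_funM => //.
  exact: measurable_powR_translate.
move=> u /=; rewrite in_itv/= andbT => u0.
rewrite -!mulrA EFinM; apply: le_trans (lee_wpmul2l _ (bound u u0)); last first.
  by rewrite lee_fin.
rewrite -ge0_integralZl//.
- rewrite le_eqVlt; apply/orP; left; apply/eqP; apply: eq_integral => y _.
  by rewrite -EFinM normrM mulrCA.
- apply/measurable_EFinP; apply: measurable_funM => //; exact: measurableT_comp.
- by move=> y _; rewrite lee_fin mulr_ge0// fractional_kernel_ge0.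
Qed.

End phase.

End smaller_exponent.

Section monotone_smaller_order.
Context {R : realType}.
Local Notation leb := (@lebesgue_measure R).
Local Notation D := (`[0, +oo[%classic : set (measurableTypeR R)).

Lemma fractional_integral1 (y : R)
    (sg : {measure set (measurableTypeR R) -> \bar R}) :
  fractional_integral 1 sg y = sg `[0%R, y[%classic.
Proof.
have mA : measurable (`[0, y[%classic : set (measurableTypeR R)) by exact: measurable_itv.
rewrite /fractional_integral -[RHS]mul1e -(integral_cst _ mA).
rewrite [LHS]integral_mkcond [RHS]integral_mkcond.
refine (@eq_integral _ _ _ sg _ _ _ (fun (u : R) _ => _)).
rewrite !patchE /fractional_kernel subrr subr_gt0.
have -> : (u \in `[0, y[%classic) = (u \in D) && (u < y).
  apply/idP/idP; first rewrite inE/= in_itv/= => /andP[u0 uy].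
    by rewrite uy andbT inE/= in_itv/= u0.
  move=> /andP[]; rewrite inE/= in_itv/= andbT => u0 uy.
  by rewrite inE/= in_itv/= u0.
case: (u \in D) => //=; case: ifPn => uy //.
by rewrite powRr0.
Qed.

(** By monotonicity an infinite value would persist on a half-line, but the
    integral of the potential against [(y + 1) ^ - g] is finite. *)
Lemma monotone_potential_fin (d g : R)
    (sg : {sigma_finite_measure set (measurableTypeR R) -> \bar R}) :
    0 < d -> d < g -> cauchy_integrable sg (g - d) ->
    {in `]0, +oo[ &, {homo fractional_integral d sg : x y / x <= y >-> (x <= y)%E}} ->
  forall y, 0 < y -> fractional_integral d sg y \is a fin_num.
Proof.
move=> d0 dg isg nd y y0; rewrite ge0_fin_numE ?fractional_integral_ge0//.
rewrite ltey; apply/eqP => yoo.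
have := fractional_integral_weighted_lty d0 dg isg.
have mI : measurable (`[y, (y + 1)]%classic : set (measurableTypeR R)).
  exact: measurable_itv.
suff -> : (\int[leb]_y (((y + 1) `^ (- g))%:E * fractional_integral d sg y) = +oo)%E.
  by rewrite ltxx.
apply/eqP; rewrite -leye_eq.
have -> : +oo%E = (\int[leb]_(t in `[y, (y + 1)%R]) cst +oo%E t)%E.
  rewrite integral_cst//= lebesgue_measure_itv/= lte_fin ltrDl ltr01.
  by rewrite -EFinB gt0_mulye// lte_fin; lra.
rewrite integral_mkcond; apply: ge0_le_integral => //.
- by move=> t _; rewrite patchE; case: ifP => _; rewrite ?leey.
- by apply/(measurable_restrictT _ _).1 => //; exact: measurable_cst.
- apply: emeasurable_funM; last exact: measurable_fractional_integral.
  by apply/measurable_EFinP; exact: measurable_powR_translate.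
move=> t _; rewrite patchE; case: ifPn => [|_]; last first.
  by rewrite mule_ge0 ?fractional_integral_ge0// lee_fin powR_ge0.
rewrite inE/= in_itv/= => /andP[yt _].
have -> : fractional_integral d sg t = +oo%E.
  by apply/eqP; rewrite -leye_eq -yoo nd ?in_itv/= ?andbT//; lra.
by rewrite gt0_muley// lte_fin powR_gt0//; lra.
Qed.

Section construction.
Variables (d a b : R).
Variable sg : {sigma_finite_measure set (measurableTypeR R) -> \bar R}.
Hypotheses (d_gt0 : 0 < d) (a_gt0 : 0 < a) (b_gt0 : 0 < b) (dab : a + 1 - d = b).
Hypothesis int_sg : cauchy_integrable sg b.
Hypothesis nd : {in `]0, +oo[ &, {homo fractional_integral d sg :
  x y / x <= y >-> (x <= y)%E}}.

Let B1 := beta_constant 1 (a + 1).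
Let B2 := beta_constant d (a + 1).
Let lt1 : 1 < a + 1. Proof. by rewrite ltrDr. Qed.
Let ltd : d < a + 1. Proof. by rewrite -subr_gt0 dab. Qed.
Let B1_gt0 : 0 < B1. Proof. exact: beta_constant_gt0. Qed.
Let B2_gt0 : 0 < B2. Proof. exact: beta_constant_gt0. Qed.
Let c := B1 / B2.

(** The potential is the fractional integral of order [d] of [sg], and [c] times
    it is almost everywhere that of order [1] of a Lebesgue-Stieltjes measure
    [nu]: both transforms are integrals of the same potential against the power
    of exponent [a + 1]. *)
Lemma measure_of_potential :
  exists2 nu : {sigma_finite_measure set (measurableTypeR R) -> \bar R},
    cauchy_integrable nu a & forall phi (w : R[i]), slit_plane w ->
    (\int[nu]_(u in D) (B1 * phase_power a phi (complex.Re w + u) (complex.Im w))%:E =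
     \int[sg]_(u in D) (B1 * phase_power b phi (complex.Re w + u) (complex.Im w))%:E)%E.
Proof.
have isg : cauchy_integrable sg (a + 1 - d) by rewrite dab.
have fin := monotone_potential_fin d_gt0 ltd isg nd.
have c0 : 0 < c by rewrite divr_gt0.
pose phi y := c * fine (fractional_integral d sg y).
have phiE y : 0 < y -> (phi y)%:E = (c%:E * fractional_integral d sg y)%E.
  by move=> y0; rewrite EFinM fineK// fin.
have [||nu nuE] := @measure_of_monotone_function _ phi.
- move=> x x0; rewrite mulr_ge0 ?(ltW c0)// fine_ge0//.
  exact: fractional_integral_ge0.
- move=> x y x0 xy; have y0 : 0 < y by exact: lt_le_trans xy.
  by rewrite ler_wpM2l ?(ltW c0)// fine_le ?fin// nd ?in_itv/= ?andbT.
have aeF : Filter (nbhs (almost_everywhere leb)) by exact: ae_filter_ringOfSetsType.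
have nu1 : {ae leb, forall y, fractional_integral 1 nu y = (c%:E * fractional_integral d sg y)%E}.
  apply: filterS nuE => y yE; have [y0|y0] := ltP 0 y.
    by rewrite fractional_integral1 -phiE//; exact: yE.
  by rewrite !fractional_integral_nonpos// mule0.
have weighted (k : R -> R) : measurable_fun setT (k : measurableTypeR R -> R) ->
    (\int[leb]_y ((k y)%:E * fractional_integral 1 nu y) =
     \int[leb]_y ((c * k y)%:E * fractional_integral d sg y))%E.
  move=> mk; apply: ae_eq_integral => //.
  - apply: emeasurable_funM; first exact/measurable_EFinP.
    exact: measurable_fractional_integral.
  - apply: emeasurable_funM; last exact: measurable_fractional_integral.
    by apply/measurable_EFinP; exact: measurable_funM.
  - apply: filterS nu1 => y -> _.
    by rewrite muleA -EFinM mulrC.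
have a1 : a + 1 - 1 = a by rewrite addrK.
have inu : cauchy_integrable nu a.
  have mw : measurable_fun setT (fun y : measurableTypeR R => (y + 1) `^ (- (a + 1))).
    exact: measurable_powR_translate.
  have := fractional_integral_weighted_lty d_gt0 ltd isg.
  have : (\int[nu]_(u in D) (B1 * (u + 1) `^ (- a))%:E =
     c%:E * \int[leb]_y (((y + 1) `^ (- (a + 1)))%:E * fractional_integral d sg y))%E.
    rewrite -[in LHS]a1 -/B1 (tonelli_powR nu ltr01 lt1 ltr01) weighted//.
    rewrite -ge0_integralZl//.
    - by apply: eq_integral => y _; rewrite muleA -EFinM.
    - apply: emeasurable_funM; first exact/measurable_EFinP.
      exact: measurable_fractional_integral.
    - by move=> y _; rewrite mule_ge0 ?fractional_integral_ge0// lee_fin powR_ge0.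
    - by rewrite lee_fin ltW.
  under eq_integral do rewrite EFinM.
  rewrite ge0_integralZl//; last 3 first.
  - by apply/measurable_EFinP; apply: measurable_funTS; exact: measurable_powR_translate.
  - by move=> u _; rewrite lee_fin powR_ge0.
  - by rewrite lee_fin ltW.
  rewrite /cauchy_integrable => h1 h2.
  have : (B1%:E * \int[nu]_(x in D) ((x + 1) `^ (- a))%:E < +oo)%E.
    by rewrite h1 lte_mul_pinfty// lee_fin ltW.
  rewrite !ltey; apply: contra => /eqP ->.
  by rewrite gt0_muley// lte_fin.
exists nu => // psi w ws.
have inu1 : cauchy_integrable nu (a + 1 - 1) by rewrite a1.
have := fubini_phase ltr01 lt1 inu1 1 psi ws.
rewrite a1 -/B1 => h.
under eq_integral do rewrite -[B1]mul1r.
rewrite h weighted; last first.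
  by apply: measurable_funM => //; exact: measurable_phase_power.
have := fubini_phase d_gt0 ltd isg c psi ws.
rewrite dab -/B2 /c divfK ?gt_eqF// => ->.
by apply: eq_integral => y _; rewrite mul1r.
Qed.

End construction.

Lemma monotone_smaller_order (b eps : R) (f : R[i] -> R[i])
    (mu : {measure set (\bar R) -> \bar R}) :
  0 < b -> represents b mu f -> 0 < eps < Num.min b 1 ->
  {in `]0, +oo[ &, {homo fractional_potential mu eps : x y /
      x <= y >-> (x <= y)%E}} ->
  stieltjes_order f < b.
Proof.
move=> b0 [hmu fE] /andP[e0]; rewrite lt_min => /andP[eb e1] nd.
have [sg sgE] := half_line_measure b0 hmu.
have [isg _] := half_line_cauchy b0 hmu sgE.
have a0 : 0 < b - eps by rewrite subr_gt0.
have d0 : 0 < 1 - eps by rewrite subr_gt0.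
have dab : b - eps + 1 - (1 - eps) = b by ring.
have ndI : {in `]0, +oo[ &, {homo fractional_integral (1 - eps) sg :
    x y / x <= y >-> (x <= y)%E}}.
  by move=> x y x0 y0 xy; rewrite -!(fractional_potentialE _ _ sgE) nd.
have [nu inu nuE] := measure_of_potential d0 a0 b0 dab isg ndI.
have [hmu0 _ hmuy] := hmu.
have fmu : mu [set +oo%E] \is a fin_num by rewrite ge0_fin_numE.
have [|mu' [mu'0 mu'y mu'E]] := @compactified_measure _ nu (fine (mu [set +oo%E])).
  exact: fine_ge0.
have hmu' : stieltjes_measure (b - eps) mu'.
  split => //; last by rewrite mu'y ltry.
  move: inu; rewrite /cauchy_integrable mu'E.
  - by under eq_integral do rewrite addrC.
  - by apply/measurable_EFinP; exact: measurable_powR_translate.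
  - by move=> u; rewrite lee_fin powR_ge0.
apply: (@le_lt_trans _ _ (b - eps)); last by rewrite ltrBlDr ltrDl.
apply: ge_inf.
  by exists 0 => a [[-> _]|[/ltW]].
right; split => //; exists mu'; split => // z zs.
rewrite fE// !stieltjes_transformE// mu'y /=.
suff phaseE phi : phase_transform mu b phi z = phase_transform mu' (b - eps) phi z.
  by rewrite !phaseE.
have B1_gt0 : 0 < beta_constant 1 (b - eps + 1) by apply: beta_constant_gt0 => //; rewrite ltrDr.
have mE := @measurable_ehalf_line R.
apply: (mulfI (lt0r_neq0 B1_gt0)).
rewrite /phase_transform -!RintegralZl//; [|exact: integrable_phase..].
rewrite /Rintegral; congr fine.
have mph g : measurable_fun setT (fun u : measurableTypeR R =>
    (beta_constant 1 (b - eps + 1) *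
     phase_power g phi (complex.Re z + u) (complex.Im z))%:E).
  by apply/measurable_EFinP; apply: measurable_funM => //; exact: measurable_phase_power.
rewrite -(half_line_measure_signed sgE (mph b)) -nuE//.
exact: (half_line_measure_signed mu'E (mph (b - eps))).
Qed.

End monotone_smaller_order.

Theorem theorem16 (R : realType) (beta : R) (f : R[i] -> R[i])
    (mu : {measure set (\bar R) -> \bar R})
    (hbeta : 0 < beta)
    (hf : represents beta mu f) :
  stieltjes_order f < beta <->
  exists eps : R, 0 < eps < Num.min beta 1 /\
    {in `]0, +oo[ &, {homo fractional_potential mu eps : x y /
      x <= y >-> (x <= y)%E}}.
Proof.
split; first exact: smaller_order_monotone.
by move=> [eps [e01 nd]]; exact: monotone_smaller_order hf e01 nd.
Qed.
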